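(* Let the Hamiltonian $(H_0,H_1)$ be ideal and let $\rho_d(t)=e^{-iH_0t}\rho_d(0)e^{iH_0t}$ be a generic non-stationary target trajectory ($[H_0,\rho_d(0)]\neq0$). If the LaSalle invariant set $E$ is regular, then any trajectory $\rho(t)$, with $\rho(0)\in\mathcal M$, of $$\dot\rho(t)=-i[H_0+f(\rho,\rho_d)H_1,\rho(t)],\quad f(\rho,\rho_d)=\mathrm{Tr}([-iH_1,\rho]\rho_d)$$ converges, as $t\to+\infty$, to one of the $n!$ critical trajectories $\rho_d^{(k)}(t)$, $k=1,\ldots,n!$. All critical trajectories are unstable, except $\rho_d(t)$, which is locally asymptotically stable, and the global maximum $\rho_d^{(n!)}(t)$, which is repulsive.
   Context: A density operator is a positive semidefinite Hermitian $n\times n$ matrix of trace $1$; it is generic if it has $n$ distinct eigenvalues. $\mathcal{M}$ is the manifold of density operators with the same spectrum as $\rho_d(0)$. One works in a basis in which $H_0=\mathrm{diag}(a_1,\ldots,a_n)$, $a_1\ge\cdots\ge a_n$; $H_1$ is Hermitian. With $\omega_{k\ell}=a_\ell-a_k$ and $b_{k\ell}$ the $(k,\ell)$ entry of $H_1$, the Hamiltonian is ideal if (i) for $k\ne\ell$, $p\ne q$, $\omega_{k\ell}\ne\omega_{pq}$ unless $(k,\ell)=(p,q)$; and (ii) $b_{k\ell}\ne0$ except (possibly) for $k=\ell$. $V(\rho,\rho_d)=\frac12\mathrm{Tr}[(\rho-\rho_d)^2]$. The LaSalle invariant set $E$ for the target trajectory $\rho_d(t)$ is the set of pairs $(\rho_1,\rho_2)$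 with $\rho_1\in\mathcal{M}$ and $\rho_2$ on the trajectory of $\rho_d$ such that $\dot V(\rho(t),\rho_d(t))=0$ for all $t$ along the joint solution of $\dot\rho=-i[H_0+f(\rho,\rho_d)H_1,\rho]$, $\dot\rho_d=-i[H_0,\rho_d]$ started at $(\rho_1,\rho_2)$. $E$ is called regular if $[\rho_1,\rho_2]=0$ for every $(\rho_1,\rho_2)\in E$, and irregular otherwise. Critical trajectories: let $\rho_d^{(k)}(0)$, $k=1,\ldots,n!$, be the critical points of $V(\cdot,\rho_d(0))$ on $\mathcal{M}$ (the elements of $\mathcal M$ commuting with $\rho_d(0)$), and $\rho_d^{(k)}(t)=e^{-iH_0t}\rho_d^{(k)}(0)e^{iH_0t}$; $\rho_d^{(n!)}$ denotes the one for which $V$ is maximal. Convergence to a trajectory means $\|\rho(t)-\rho_d^{(k)}(t)\|\to0$. A critical trajectory is stable if for every $\varepsilon>0$ there is $\delta>0$ such that $\|\rho(0)-\rho_d^{(k)}(0)\|<\delta$ implies $\|\rho(t)-\rho_d^{(k)}(t)\|<\varepsilon$ for all $t\ge0$; unstable if not stable; locally asymptotically stable if it is stable and all solutions starting sufficiently near converge to it; repulsive if no solution other than itself converges to it. *)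

(* Defs.v *)
From HB Require Import structures.
From mathcomp Require Import all_boot all_order all_algebra.
From mathcomp Require Import all_classical all_reals all_analysis.
From mathcomp Require Import complex.

Set Implicit Arguments.
Unset Strict Implicit.
Unset Printing Implicit Defensive.

Import Order.TTheory GRing.Theory Num.Theory numFieldNormedType.Exports.

Local Open Scope classical_set_scope.
Local Open Scope sesquilinear_scope.
Local Open Scope ring_scope.

Section Matrices.
Variables (R : realType) (n : nat).
Local Notation M := 'M[R[i]]_n.
Implicit Types A B H X Y rhod : M.

Definition bracket A B : M := A *m B - B *m A.

Definition frob_norm A : R :=
  Num.sqrt (\sum_(k < n) \sum_(l < n)
    (complex.Re (A k l) ^+ 2 + complex.Im (A k l) ^+ 2)).

(* The exponential series, summed entrywise on real and imaginary parts. *)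
Definition expmx A : M := \matrix_(k < n, l < n)
  (limn (series (fun m => complex.Re ((A ^+ m) k l) / m`!%:R)) +i*
   limn (series (fun m => complex.Im ((A ^+ m) k l) / m`!%:R)))%C.

(* In [R[i]], [0 <= z] says that z is real and nonnegative. *)
Definition psdmx A : Prop :=
  forall u : 'cV[R[i]]_n, 0 <= (u ^t* *m A *m u) 0 0.

Definition density_operator A : Prop :=
  [/\ A \is hermsymmx, psdmx A & \tr A = 1].

Definition generic A : Prop := exists s : seq R[i],
  [/\ uniq s, size s = n & forall z, z \in s -> eigenvalue A z].

(* The spectrum is counted with multiplicities. *)
Definition isospectral_manifold A : set M :=
  [set X | density_operator X /\ char_poly X = char_poly A].

Definition critical_points A : set M :=
  [set X | isospectral_manifold A X /\ bracket X A = 0].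

(* [complex.Re] loses nothing on Hermitian matrices, see [distVE]. *)
Definition distV X Y : R := complex.Re (\tr ((X - Y) ^+ 2)) / 2.

(* [complex.Re] loses nothing on Hermitian matrices, see [feedbackE]. *)
Definition feedback H1 X Y : R :=
  complex.Re (\tr (bracket (- 'i%C *: H1) X *m Y)).

Lemma hermsymmxE A : A \is hermsymmx -> A ^t* = A.
Proof. by move=> /is_hermitianmxP; rewrite expr0 scale1r => <-. Qed.

Lemma mxtrace_hermM A B : A \is hermsymmx -> B \is hermsymmx ->
  (complex.Re (\tr (A *m B)))%:C%C = \tr (A *m B).
Proof.
move=> /hermsymmxE hA /hermsymmxE hB.
have : (\tr (A *m B))^* = \tr (A *m B).
  rewrite -[LHS]/(Num.conj _) -trace_map_mx -mxtrace_tr map_trmx trmx_mul.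
  by rewrite map_mxM hA hB mxtrace_mulC.
case: (\tr _) => x y /(congr1 (@complex.Im R)) /= /eqP.
by rewrite eq_sym -subr_eq0 opprK -mulr2n mulrn_eq0 /= => /eqP ->.
Qed.

Lemma distVE X Y : X \is hermsymmx -> Y \is hermsymmx ->
  (distV X Y)%:C%C = \tr ((X - Y) ^+ 2) / 2.
Proof.
move=> hX hY.
have hXY : X - Y \is hermsymmx.
  apply/is_hermitianmxP; rewrite expr0 scale1r linearB map_mxB /=.
  by rewrite !hermsymmxE.
have := mxtrace_hermM hXY hXY; rewrite /distV expr2 => <-.
by rewrite -[LHS]/(real_complex R _) rmorphM fmorphV rmorph_nat.
Qed.

Lemma feedbackE H1 X Y :
  H1 \is hermsymmx -> X \is hermsymmx -> Y \is hermsymmx ->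
  (feedback H1 X Y)%:C%C = \tr (bracket (- 'i%C *: H1) X *m Y).
Proof.
move=> hH hX hY; rewrite /feedback mxtrace_hermM //.
apply/is_hermitianmxP; rewrite expr0 scale1r linearB map_mxB /=.
rewrite !trmx_mul !map_mxM linearZ map_mxZ /= !hermsymmxE //.
have -> : (- 'i%C : R[i])^* = 'i%C.
  by apply/eqP; rewrite eq_complex /= oppr0 opprK !eqxx.
by rewrite /bracket -!scalemxAl -!scalemxAr !scaleNr opprK addrC.
Qed.

(* The adjoint action of the free propagator: e^(-i H0 t) X e^(i H0 t). *)
Definition free_evolution H0 X (t : R) : M :=
  expmx (- ('i%C * t%:C%C) *: H0) *m X *m expmx (('i%C * t%:C%C) *: H0).

(* x' = v on the interval J, with continuity up to the endpoints of J. *)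
Definition has_velocity (J : set R) (x v : R -> M) : Prop :=
  forall k l,
  [/\ {within J, continuous (fun t => complex.Re (x t k l))},
      {within J, continuous (fun t => complex.Im (x t k l))} &
      forall t, interior J t ->
        is_derive t (1 : R) (fun s => complex.Re (x s k l))
                            (complex.Re (v t k l)) /\
        is_derive t (1 : R) (fun s => complex.Im (x s k l))
                            (complex.Im (v t k l))].

Definition controlled (J : set R) H0 H1 (rho rhod : R -> M) : Prop :=
  has_velocity J rho (fun t =>
    - 'i%C *: bracket (H0 + (feedback H1 (rho t) (rhod t))%:C%C *: H1) (rho t)).

Definition uncontrolled (J : set R) H0 (rhod : R -> M) : Prop :=
  has_velocity J rhod (fun t => - 'i%C *: bracket H0 (rhod t)).

Definition LaSalle_set H0 H1 rhod0 : set (M * M) :=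
  [set p | [/\ isospectral_manifold rhod0 p.1,
               exists s : R, p.2 = free_evolution H0 rhod0 s &
               exists rho rhod : R -> M,
               [/\ rho 0 = p.1 /\ rhod 0 = p.2,
                   controlled setT H0 H1 rho rhod,
                   uncontrolled setT H0 rhod &
                   forall t : R, is_derive t (1 : R)
                     (fun s => distV (rho s) (rhod s)) 0]]].

Definition LaSalle_regular H0 H1 rhod0 : Prop :=
  forall p, LaSalle_set H0 H1 rhod0 p -> bracket p.1 p.2 = 0.

Definition trajectory H0 H1 rhod0 (rho : R -> M) : Prop :=
  isospectral_manifold rhod0 (rho 0) /\
  controlled `[0, +oo[ H0 H1 rho (free_evolution H0 rhod0).

(* Below, X is the initial point of a free trajectory. *)
Definition converges_to H0 (rho : R -> M) X : Prop :=
  (fun t => frob_norm (rho t - free_evolution H0 X t)) @ +oo --> (0 : R).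

Definition stable H0 H1 rhod0 X : Prop :=
  forall eps : R, 0 < eps -> exists2 delta : R, 0 < delta &
  forall rho, trajectory H0 H1 rhod0 rho -> frob_norm (rho 0 - X) < delta ->
  forall t, 0 <= t -> frob_norm (rho t - free_evolution H0 X t) < eps.

Definition locally_asymptotically_stable H0 H1 rhod0 X : Prop :=
  stable H0 H1 rhod0 X /\
  exists2 delta : R, 0 < delta &
  forall rho, trajectory H0 H1 rhod0 rho -> frob_norm (rho 0 - X) < delta ->
  converges_to H0 rho X.

Definition repulsive H0 H1 rhod0 X : Prop :=
  forall rho, trajectory H0 H1 rhod0 rho -> converges_to H0 rho X ->
  forall t, 0 <= t -> rho t = free_evolution H0 X t.

Definition diag_hamiltonian (a : 'rV[R]_n) : M :=
  diag_mx (map_mx (real_complex R) a).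

Definition ideal (a : 'rV[R]_n) H1 : Prop :=
  let omega (k l : 'I_n) := a 0 l - a 0 k in
  (forall k l p q : 'I_n, k != l -> p != q -> omega k l = omega p q ->
     (k, l) = (p, q)) /\
  (forall k l : 'I_n, k != l -> H1 k l != 0).

End Matrices.

(* Main.v *)
Require Import Defs.
From mathcomp Require Import all_boot all_order all_algebra.
From mathcomp Require Import all_classical all_reals all_analysis.
From mathcomp Require Import perm.
From mathcomp Require Import complex ring lra.

Set Implicit Arguments.
Unset Strict Implicit.
Unset Printing Implicit Defensive.

Import Order.TTheory GRing.Theory Num.Theory numFieldNormedType.Exports.

Local Open Scope classical_set_scope.
Local Open Scope sesquilinear_scope.
Local Open Scope ring_scope.

(** In the interaction picture sigma(t) = e^(i H0 t) rho(t) e^(- i H0 t) the target is the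
    constant rhod0, the equation of motion is sigma' = f [- i H1(t), sigma] with
    H1(t) = e^(i H0 t) H1 e^(- i H0 t), and V(sigma, rhod0)' = - f^2.  As f is Lipschitz,
    f -> 0 (Barbalat), so sigma is asymptotically constant on bounded time windows.  Let A
    be the limit of sigma along an ultrafilter tending to +oo.  For every s the
    trigonometric sum g(t) = tr ([- i H1(t), A] rhod0) satisfies g(t + s) -> 0 along that
    ultrafilter; extracting one frequency at a time by finite differences, g vanishes
    identically.  Hence (A, rhod0) lies in the LaSalle set, and regularity makes A critical.
    The critical points are the n! rearrangements of the spectrum of rhod0, so they are
    isolated and the continuous curve sigma converges to one of them.

    Stability of rhod0 holds because the squared distance to the target is 2 V.  The
    maximum of V on the isospectral manifold is attained, and attained at critical points
    only: elsewhere a rotation in the plane of two eigenvectors of rhod0 changes V to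
    first order.  A trajectory converging to a maximal critical point has V at its maximum
    all the time, so it consists of critical points and is constant.  Near any
    other critical point than rhod0 a rotation exchanging an inverted pair of eigenvalues
    lowers V, and the solution issued from there, which must converge, goes elsewhere.

    Solutions exist because the unitary propagator solves an equation with a bounded
    Lipschitz field, once the field is cut off outside the unitary group; the same
    theorem provides the propagator that makes given trajectories isospectral. *)

(** * Differential equations on the half line *)

Section HalfLine.
Context {R : realType}.
Implicit Types (f g u h : R -> R) (s t : R).

Definition hnbhs t : set_system R := within `[0, +oo[ (nbhs t).

Global Instance hnbhs_filter t : Filter (hnbhs t).
Proof. exact: within_filter. Qed.

Definition hcont f := forall t, 0 <= t -> f @ hnbhs t --> f t.

Lemma hcontE f : {within `[0, +oo[, continuous f} <-> hcont f.
Proof.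
have A0 t : 0 <= t -> [set` `[0, +oo[] t by rewrite /= in_itv /= andbT.
split=> [cf t t0|cf t].
  have := cf t; rewrite /prop_for /continuous_at.
  by rewrite -[nbhs (t : subspace _)](nbhs_subspace_in (A0 _ t0)).
rewrite /prop_for /continuous_at.
case: (@nbhs_subspaceP R `[0, +oo[ t) => [|_].
  by rewrite /= in_itv /= andbT; exact: cf.
by move=> A /= /nbhs_singleton At _ ->.
Qed.

Lemma hnbhsP t (P : R -> Prop) :
  hnbhs t P <-> exists2 d, 0 < d & forall s, 0 <= s -> `|t - s| < d -> P s.
Proof.
split=> [|[d d0 H]].
  move=> /nbhs_ballP[d /= d0 H]; exists d => // s s0 ts.
  by apply: H => //=; rewrite in_itv /= s0.
apply/nbhs_ballP; exists d => //= s ts; rewrite in_itv /= andbT => s0.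
exact: H.
Qed.

(** Continuity up to 0 with a derivative at positive times only is what [has_velocity] gives on the
    closed half line, and it is all that the mean value theorem asks for. *)
Definition hder f g := hcont f /\ forall t, 0 < t -> is_derive t (1 : R) f (g t).

Lemma hder_mono f g : hder f g -> (forall t, 0 < t -> 0 <= g t) ->
  forall s t, 0 <= s -> s <= t -> f s <= f t.
Proof.
move=> [cf df] g0 s t s0 st; rewrite le_eqVlt in st.
case/orP: st => [/eqP -> //|st].
have sub : {within `[s, t], continuous f}.
  move/hcontE : cf; apply: continuous_subspaceW => x /=.
  by rewrite !in_itv /= andbT => /andP[/(le_trans s0) ->].
have [x|c] := @MVT R f g s t st _ sub.
  by rewrite in_itv /= => /andP[sx _]; apply: df; exact: le_lt_trans sx.
rewrite in_itv /= => /andP[sc _] E.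
by rewrite -subr_ge0 E mulr_ge0 ?subr_ge0 ?(ltW st) // g0 // (le_lt_trans s0).
Qed.

Lemma hcont_cst (a : R) : hcont (fun=> a).
Proof. by move=> t _; exact: cvg_cst. Qed.

Lemma hcontD f g : hcont f -> hcont g -> hcont (fun t => f t + g t).
Proof. by move=> cf cg t t0; apply: cvgD; [exact: cf|exact: cg]. Qed.

Lemma hcontN f : hcont f -> hcont (fun t => - f t).
Proof. by move=> cf t t0; apply: cvgN; exact: cf. Qed.

Lemma continuous_hcont f : continuous f -> hcont f.
Proof. by move=> cf t _; apply: cvg_within_filter; exact: cf. Qed.

Lemma hderD f g u h : hder f g -> hder u h ->
  hder (fun t => f t + u t) (fun t => g t + h t).
Proof.
move=> [cf df] [cu du]; split; first exact: hcontD.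
by move=> t t0; apply: is_deriveD; [exact: df|exact: du].
Qed.

Lemma hderN f g : hder f g -> hder (fun t => - f t) (fun t => - g t).
Proof.
move=> [cf df]; split; first exact: hcontN.
by move=> t t0; apply: is_deriveN; exact: df.
Qed.

Lemma hder_cst (a : R) : hder (fun=> a) (fun=> 0).
Proof. by split; [exact: hcont_cst|move=> t _; exact: is_derive_cst]. Qed.

(** Both [u - f] and [u + f] are nondecreasing. Applied with an explicit [u], this does the work of
    bounding an integral. *)
Lemma hder_dominated f g u h : hder f g -> hder u h ->
  (forall t, 0 < t -> `|g t| <= h t) ->
  forall s t, 0 <= s -> s <= t -> `|f t - f s| <= u t - u s.
Proof.
move=> df du gh s t s0 st.
have B pos := hder_mono (hderD du df) pos s0 st.
have A pos := hder_mono (hderD du (hderN df)) pos s0 st.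
have {A} : u s - f s <= u t - f t.
  by apply: A => r /gh; rewrite ler_norml => /andP[_]; rewrite subr_ge0.
have {B} : u s + f s <= u t + f t.
  by apply: B => r /gh; rewrite ler_norml => /andP[+ _]; rewrite -subr_ge0 opprK addrC.
by move=> A B; rewrite ler_norml; apply/andP; split; lra.
Qed.

Lemma hder_eq0 f g : hder f g -> (forall t, 0 < t -> g t = 0) ->
  forall t, 0 <= t -> f t = f 0.
Proof.
move=> df g0 t t0; apply/eqP; rewrite -subr_eq0 -normr_le0.
have := hder_dominated df (hder_cst 0) _ (lexx 0) t0.
by rewrite subrr; apply => s /g0 ->; rewrite normr0.
Qed.

Lemma hder_linear (K : R) : hder (fun t => K * t) (fun=> K).
Proof.
split; first by apply: continuous_hcont; exact: mulrl_continuous.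
move=> t _; have := is_deriveZ K (is_derive_id t (1 : R)).
by move/is_derive_eq; apply; rewrite /GRing.scale /= mulr1.
Qed.

Lemma hder_exp (K C : R) : K != 0 ->
  hder (fun t => C / K * expR (K * t)) (fun t => C * expR (K * t)).
Proof.
move=> K0.
have D t : is_derive t (1 : R) (fun t => C / K * expR (K * t)) (C * expR (K * t)).
  have D1 : is_derive t (1 : R) (fun t => K * t) K.
    have := is_deriveZ K (is_derive_id t (1 : R)).
    by move/is_derive_eq; apply; rewrite /GRing.scale /= mulr1.
  have D2 := @is_derive1_comp _ expR (fun t => K * t) t _ _ (is_derive_expR (K * t)) D1.
  have := is_deriveZ (C / K) D2.
  by move/is_derive_eq; apply; rewrite /GRing.scale /=; field.
split=> [|t _]; last exact: D.
apply: continuous_hcont => t; apply: differentiable_continuous.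
by apply/derivable1_diffP; exact: ex_derive.
Qed.

Lemma hder_Lipschitz f g (K : R) : hder f g -> (forall t, 0 < t -> `|g t| <= K) ->
  forall s t, 0 <= s -> 0 <= t -> `|f t - f s| <= K * `|t - s|.
Proof.
move=> df gK s t s0 t0.
wlog st : s t s0 t0 / s <= t.
  by move=> H; have [/H|/ltW/H] := leP s t; [exact|rewrite distrC (distrC t); exact].
rewrite (ger0_norm (_ : 0 <= t - s)) ?subr_ge0 // mulrBr.
by apply: (hder_dominated df (hder_linear K)).
Qed.

(** Fundamental theorem of calculus, with [g] extended evenly to a continuous function on the
    line. *)
Lemma hder_antiderivative g (c : R) : hcont g ->
  exists2 z : R -> R, z 0 = c & hder z g.
Proof.
move=> cg; pose G t := g `|t|.
have cG : continuous G.
  move=> t; apply: (@cvg_comp _ _ _ (fun t : R => `|t|) g _ (hnbhs `|t|)).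
    move=> A [d /= d0 H]; exists d => //= s ts; apply: H => /=.
      by apply: le_lt_trans ts; exact: ler_dist_dist.
    by rewrite in_itv /= normr_ge0.
  exact: cg.
(* Integrating from -1 puts 0 inside the interval, so the primitive is differentiable, hence
   continuous, at 0 as well. *)
pose Z (y : R) := (\int[@lebesgue_measure R]_(t in `[(-1 : R), y]) G t)%R.
have dZ t : -1 < t -> derivable Z t 1 /\ derive1 Z t = G t.
  move=> t1; apply: (@continuous_FTC1_closed R G (-1) t (t + 1)).
  - by rewrite ltrDl.
  - apply: continuous_compact_integrable; first exact: segment_compact.
    exact: continuous_subspaceT.
  - exact: t1.
  - exact: cG.
exists (fun t => Z t + (c - Z 0)); first by rewrite addrC subrK.
split=> t t0.
  apply: cvgD; last exact: cvg_cst.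
  apply: cvg_within_filter; apply: differentiable_continuous.
  by apply/derivable1_diffP; apply: (dZ _ _).1; exact: lt_le_trans t0.
have [dt Zt] := dZ t (lt_trans (ltrN10 R) t0).
have H : is_derive t (1 : R) Z (g t).
  by split => //; rewrite -derive1E Zt /G gtr0_norm.
by have := is_deriveD H (is_derive_cst (c - Z 0) t 1); rewrite addr0.
Qed.

End HalfLine.

(** * Global solutions for bounded Lipschitz fields *)

Section Picard.
Context {R : realType}.

Lemma hder_ext (f g h : R -> R) : hder f g -> (forall t, 0 < t -> g t = h t) ->
  hder f h.
Proof. by move=> [cf df] gh; split=> // t t0; rewrite -gh //; exact: df. Qed.

Lemma hcont_Lipschitz (f : R -> R) (K : R) :
  (forall s t, 0 <= s -> 0 <= t -> `|f t - f s| <= K * `|t - s|) -> hcont f.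
Proof.
move=> fK t t0; apply/cvgrPdist_lt => e e0; apply/hnbhsP.
have K1 : 0 < `|K| + 1 by rewrite ltr_wpDl.
exists (e / (`|K| + 1)); first by rewrite divr_gt0.
move=> s s0; rewrite ltr_pdivlMr // => ts.
apply: le_lt_trans ts; apply: le_trans (fK _ _ s0 t0) _.
rewrite mulrC ler_wpM2l //; apply: le_trans (ler_norm K) _.
by rewrite lerDl.
Qed.

(** A geometric Cauchy criterion with explicit rate, reduced to the convergence of a bounded
    monotone sequence. *)
Lemma halving_seq_dist (u : nat -> R) (B : R) :
  (forall m, `|u m.+1 - u m| <= B / 2 ^+ m) ->
  exists l, forall m, `|l - u m| <= 2 * B / 2 ^+ m.
Proof.
move=> uB.
have uk m k : `|u (m + k)%N - u m| <= 2 * B / 2 ^+ m - 2 * B / 2 ^+ (m + k).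
  elim: k => [|k IH]; first by rewrite addn0 !subrr normr0.
  rewrite addnS -(subrKA (u (m + k)%N)).
  apply: le_trans (ler_normD _ _) _.
  have := lerD (uB (m + k)%N) IH; move/le_trans; apply.
  rewrite exprS invfM.
  rewrite (_ : 2 * B * (2^-1 / 2 ^+ (m + k)) = B / 2 ^+ (m + k)); last by field.
  by rewrite le_eqVlt; apply/orP; left; apply/eqP; ring.
have B0 : 0 <= B by have := uB 0; rewrite expr0 divr1; apply: le_trans.
have P0 m : 0 <= 2 * B / 2 ^+ m by rewrite divr_ge0 ?mulr_ge0 ?exprn_ge0.
have uk' m k : (m <= k)%N -> `|u k - u m| <= 2 * B / 2 ^+ m.
  move=> /subnKC <-; apply: le_trans (uk _ _) _.
  by rewrite lerBlDr lerDl.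
(* Subtracting the geometric tail bound from [u m] makes the sequence nondecreasing. *)
pose S m := u m - 2 * B / 2 ^+ m.
have ndS : nondecreasing_seq S.
  move=> m k mk; rewrite /S; have := uk m (k - m)%N; rewrite subnKC // ler_norml => /andP[+ _].
  lra.
have cS : cvgn S.
  apply: nondecreasing_is_cvgn => //; exists (u 0%N + 2 * B) => _ [m _ <-] /=.
  have := uk' 0%N m (leq0n _); rewrite expr0 divr1 ler_norml => /andP[_ +].
  by have := P0 m; rewrite /S; lra.
exists (limn S) => m; rewrite ler_norml; apply/andP; split.
  have := nondecreasing_cvgn_le ndS cS m; rewrite /S; lra.
suff : limn S <= u m + 2 * B / 2 ^+ m by lra.
apply: limr_le => //; exists m => //= k mk.
have := uk' _ _ mk; rewrite ler_norml => /andP[_ +].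
by have := P0 k; rewrite /S; lra.
Qed.

Lemma halving_le0 (a B : R) : (forall m, `|a| <= B / 2 ^+ m) -> a = 0.
Proof.
move=> H; apply/eqP; rewrite -normr_le0 leNgt; apply/negP => a0.
have B0 : 0 < B by have := H 0%N; rewrite expr0 divr1; exact: lt_le_trans.
have [m Hm] : exists m : nat, B / `|a| < m%:R.
  by exists (Num.bound (B / `|a|)); have := archi_boundP (ltW (divr_gt0 B0 a0)).
have := H m; rewrite leNgt => /negP; apply.
rewrite ltr_pdivrMr ?exprn_gt0 // mulrC -ltr_pdivrMr //.
apply: lt_le_trans Hm _; rewrite -natrX ler_nat; exact/ltnW/ltn_expl.
Qed.

Variables (I : finType) (K : R) (F : R -> (I -> R) -> I -> R).
Hypothesis F_bounded : forall t x i, `|F t x i| <= K.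
Hypothesis F_Lipschitz : forall t s x y i,
  `|F t x i - F s y i| <= K * (`|t - s| + \sum_j `|x j - y j|).

Lemma field_along_hcont (x : R -> I -> R) i : 0 <= K ->
  (forall j, hcont (fun t => x t j)) -> hcont (fun t => F t (x t) i).
Proof.
move=> K0 cx t t0; apply/cvgrPdist_lt => e e0.
have : (fun s => K * (`|t - s| + \sum_j `|x t j - x s j|)) @ hnbhs t --> (0 : R).
  rewrite -[X in _ --> X](mulr0 K); apply: cvgMr.
  rewrite -[X in _ --> X](addr0 (0 : R)); apply: cvgD.
    rewrite -(normr0 R) -(subrr t); apply: cvg_norm; apply: cvgB; first exact: cvg_cst.
    exact: cvg_within.
  rewrite [X in _ --> X](_ : 0 = \sum_(j : I) (0 : R)); last by rewrite big1.
  apply: cvg_big; first by apply: add_continuous.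
  move=> j _; rewrite -(normr0 R) -(subrr (x t j)).
  by apply: cvg_norm; apply: cvgB; [exact: cvg_cst|exact: cx].
move/cvgrPdist_lt/(_ e e0); apply: filterS => s.
rewrite sub0r normrN; apply: le_lt_trans.
by apply: le_trans (ler_norm _); exact: F_Lipschitz.
Qed.

(* Picard's iterates are compared in the norm weighted by [expR (- k * t)], in which
   the integral operator halves distances. *)
Theorem bounded_Lipschitz_ode (X : I -> R) : exists x : R -> I -> R,
  (forall i, x 0 i = X i) /\
  forall i, hder (fun t => x t i) (fun t => F t (x t) i).
Proof.
have [K0|K0] := leP 0 K; last first.
  exists (fun _ => X); split=> // i.
  by have := F_bounded 0 X i; move/(le_trans (normr_ge0 _)); rewrite leNgt K0.
(* [choice] asks for an operator on all curves; its value at a discontinuous one is arbitrary. *)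
have step x : exists y : R -> I -> R, (forall i, hcont (fun t => x t i)) ->
    forall i, y 0 i = X i /\ hder (fun t => y t i) (fun t => F t (x t) i).
  have [cx|ncx] := pselect (forall i, hcont (fun t => x t i)); last by exists x.
  have /choice[z Hz] i : exists z : R -> R, z 0 = X i /\ hder z (fun t => F t (x t) i).
    by have [z] := hder_antiderivative (X i) (field_along_hcont (i := i) K0 cx); exists z.
  by exists (fun t i => z i t) => _ i; exact: Hz.
have {step} [S HS] := choice step.
pose xs m := iter m S (fun=> X).
have cxs m i : hcont (fun t => xs m t i).
  elim: m i => [|m IH] i; first exact: hcont_cst.
  by have [_ []] := HS _ IH i.
have xs0 m i : xs m 0 i = X i by case: m => [//|m]; have [] := HS _ (cxs m) i.
have dxs m i : hder (fun t => xs m.+1 t i) (fun t => F t (xs m t) i).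
  by have [] := HS _ (cxs m) i.
have xsL m i s t : 0 <= s -> 0 <= t -> `|xs m t i - xs m s i| <= K * `|t - s|.
  case: m => [|m] s0 t0; first by rewrite subrr normr0 mulr_ge0.
  exact: (hder_Lipschitz (dxs m i)).
(* Integrating [K * #|I| * expR (k * s)] gives a factor [K * #|I| / k], which is below 1/2 for this
   [k]; the added 2 keeps [k] positive. *)
pose k := 2 * (K * #|I|%:R) + 2.
have KI0 : 0 <= K * #|I|%:R by rewrite mulr_ge0.
have k0 : 0 < k by rewrite /k; lra.
have kN0 : k != 0 by rewrite gt_eqF.
pose C := K / k.
have C0 : 0 <= C by rewrite divr_ge0 // ltW.
have contr x y B m : (forall j t, 0 <= t -> `|x t j - y t j| <= B / 2 ^+ m * expR (k * t)) ->
    0 <= B -> forall i (z w : R -> R), z 0 = X i -> w 0 = X i ->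
    hder z (fun t => F t (x t) i) -> hder w (fun t => F t (y t) i) ->
    forall t, 0 <= t -> `|z t - w t| <= B / 2 ^+ m.+1 * expR (k * t).
  move=> xy B0 i z w z0 w0 dz dw t t0.
  have := hder_dominated (hderD dz (hderN dw))
    (hder_exp (K * #|I|%:R * (B / 2 ^+ m)) kN0) _ (lexx 0) t0.
  rewrite z0 w0 subrr subr0 mulr0 expR0 => H; apply: le_trans (H _) _.
    move=> s s0; apply: le_trans (F_Lipschitz _ _ _ _ _) _.
    rewrite subrr normr0 add0r -!mulrA ler_wpM2l //.
    apply: (@le_trans _ _ (\sum_(j : I) (B / 2 ^+ m * expR (k * s)))).
      by apply: ler_sum => j _; apply: xy; exact: ltW.
    by rewrite sumr_const mulr_natl mulrA.
  have BB : 0 <= B / 2 ^+ m by rewrite divr_ge0 // exprn_ge0.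
  apply: (@le_trans _ _ (K * #|I|%:R * (B / 2 ^+ m) / k * expR (k * t))).
    by rewrite lerBlDr lerDl mulr1 divr_ge0 ?(ltW k0) // mulr_ge0.
  rewrite ler_wpM2r ?expR_ge0 //.
  have -> : B / 2 ^+ m.+1 = B / 2 ^+ m / 2 by rewrite exprS invfM; field.
  move: (B / 2 ^+ m) BB => b BB; rewrite ler_pdivrMr //.
  have -> : b / 2 * k = K * #|I|%:R * b + b by rewrite /k; field.
  by rewrite lerDl.
have inc m i t : 0 <= t -> `|xs m.+1 t i - xs m t i| <= C / 2 ^+ m * expR (k * t).
  elim: m i t => [|m IH] i t t0.
    have := hder_dominated (dxs 0%N i) (hder_exp K kN0) _ (lexx 0) t0.
    rewrite xs0 mulr0 expR0 mulr1 expr0 divr1 => H; apply: le_trans (H _) _; last first.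
      by rewrite lerBlDr lerDl.
    move=> s s0; apply: le_trans (F_bounded _ _ _) _.
    by rewrite ler_peMr // -expR0 ler_expR mulr_ge0 ?ltW.
  apply: (contr (xs m.+1) (xs m) C m _ C0 i (fun t => xs m.+2 t i)
    (fun t => xs m.+1 t i) (xs0 _ _) (xs0 _ _) (dxs _ _) (dxs _ _) t t0).
  by move=> j s; exact: IH.
(* At negative times nothing is claimed and 0 serves as value. *)
have lim t i : exists l, 0 <= t -> forall m, `|l - xs m t i| <= 2 * C / 2 ^+ m * expR (k * t).
  have [t0|t0] := leP 0 t; last by exists 0.
  have [|l Hl] := @halving_seq_dist (fun m => xs m t i) (C * expR (k * t)).
    by move=> m; rewrite mulrAC; exact: inc.
  by exists l => _ m; have := Hl m; rewrite mulrA mulrAC.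
have /choice[x Hx] (t : R) : exists l : I -> R, forall i, 0 <= t -> forall m,
    `|l i - xs m t i| <= 2 * C / 2 ^+ m * expR (k * t).
  by have [l] := choice (lim t); exists l.
have C20 : 0 <= 2 * C by rewrite mulr_ge0.
(* The Lipschitz bound of the iterates passes to the limit. It makes [x] continuous, so that the
   field along [x] has a primitive. *)
have xL i s t : 0 <= s -> 0 <= t -> `|x t i - x s i| <= K * `|t - s|.
  move=> s0 t0; rewrite -subr_le0 leNgt; apply/negP => d0.
  have := @halving_le0 (`|x t i - x s i| - K * `|t - s|)
     (2 * C * expR (k * t) + 2 * C * expR (k * s)).
  move=> E; suff E0 : `|x t i - x s i| - K * `|t - s| = 0 by rewrite E0 ltxx in d0.
  apply: E => m; rewrite (gtr0_norm d0).
  have A1 := Hx t i t0 m; have A2 := Hx s i s0 m; have A3 := xsL m i s t s0 t0.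
  have : `|x t i - x s i| <= `|x t i - xs m t i| + `|xs m t i - xs m s i| + `|x s i - xs m s i|.
    rewrite (_ : x t i - x s i = (x t i - xs m t i) + (xs m t i - xs m s i) -
      (x s i - xs m s i)); last by ring.
    by apply: le_trans (ler_normB _ _) _; rewrite lerD2r ler_normD.
  by rewrite mulrDl ![_ * _ / _]mulrAC; lra.
have cx i : hcont (fun t => x t i) by apply: hcont_Lipschitz => s t; exact: xL.
have /choice[z Hz] i : exists z : R -> R, z 0 = X i /\ hder z (fun t => F t (x t) i).
  by have [z] := hder_antiderivative (X i) (field_along_hcont (i := i) K0 cx); exists z.
(* The primitive [z] and the iterate [m.+1] are the images of [x] and of the iterate [m] under the
   integral operator; contraction forces [z = x]. *)
have zx i t : 0 <= t -> z i t = x t i.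
  move=> t0; apply/eqP; rewrite -subr_eq0; apply/eqP.
  apply: (@halving_le0 _ (2 * (2 * C * expR (k * t)))) => m.
  have A1 := contr x (xs m) (2 * C) m (fun j t t0 => Hx t j t0 m) C20 i (z i) (fun t => xs m.+1 t i)
    (Hz i).1 (xs0 _ _) (Hz i).2 (dxs m i) t t0.
  have A2 := Hx t i t0 m.+1.
  have : `|z i t - x t i| <= `|z i t - xs m.+1 t i| + `|x t i - xs m.+1 t i|.
    rewrite (_ : z i t - x t i = (z i t - xs m.+1 t i) - (x t i - xs m.+1 t i)); last by ring.
    exact: ler_normB.
  move=> A3; apply: le_trans A3 _; apply: le_trans (lerD A1 A2) _.
  rewrite exprS invfM.
  have -> : 2 * C * (2^-1 / 2 ^+ m) * expR (k * t) = C * expR (k * t) / 2 ^+ m by field.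
  have : 0 <= C * expR (k * t) / 2 ^+ m 
    by apply: divr_ge0; [apply: mulr_ge0 => //; exact: expR_ge0|exact: exprn_ge0].
  have -> : 2 * (2 * C * expR (k * t)) / 2 ^+ m = 4 * (C * expR (k * t) / 2 ^+ m) by ring.
  by move: (C * expR (k * t) / 2 ^+ m) => q; lra.
exists (fun t i => z i t); split=> i; first exact: (Hz i).1.
apply: hder_ext (Hz i).2 _ => t t0; congr F.
by apply/funext => j; rewrite zx // ltW.
Qed.

End Picard.

(** * Limits, bounds and derivatives of matrix-valued functions *)

Section RingRelation.
Context {R : realType} {T : Type}.
Implicit Types (P : (T -> R) -> R -> Prop).

(* The closure properties shared by convergence along a filter, where [P f a] says
   that [f] tends to [a], and by bounded Lipschitz functions, where [a] is a dummy. *)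
Definition ring_relation P :=
  [/\ forall c, P (fun=> c) c,
      forall f g a b, P f a -> P g b -> P (fun t => f t + g t) (a + b) &
      forall f g a b, P f a -> P g b -> P (fun t => f t * g t) (a * b)].

Variables (P : (T -> R) -> R -> Prop) (rP : ring_relation P).

Lemma rel_cst c : P (fun=> c) c. Proof. by case: rP. Qed.

Lemma relD f g a b : P f a -> P g b -> P (fun t => f t + g t) (a + b).
Proof. by case: rP => _ + _; apply. Qed.

Lemma relM f g a b : P f a -> P g b -> P (fun t => f t * g t) (a * b).
Proof. by case: rP => _ _; apply. Qed.

Lemma relN f a : P f a -> P (fun t => - f t) (- a).
Proof.
move=> /(relM (rel_cst (-1))); rewrite mulN1r.
by under eq_fun do rewrite mulN1r.
Qed.

Lemma relB f g a b : P f a -> P g b -> P (fun t => f t - g t) (a - b).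
Proof. by move=> Pf /relN; exact: relD. Qed.

Lemma rel_sum (I : Type) (r : seq I) (f : I -> T -> R) (a : I -> R) :
  (forall i, P (f i) (a i)) -> P (fun t => \sum_(i <- r) f i t) (\sum_(i <- r) a i).
Proof.
move=> Pf; elim: r => [|i r IH].
  by under eq_fun do rewrite big_nil; rewrite big_nil; exact: rel_cst.
by under eq_fun do rewrite big_cons; rewrite big_cons; exact: relD.
Qed.

Definition crel (x : T -> R[i]) (z : R[i]) :=
  P (fun t => complex.Re (x t)) (complex.Re z) /\
  P (fun t => complex.Im (x t)) (complex.Im z).

Lemma crel_cst z : crel (fun=> z) z.
Proof. by split; exact: rel_cst. Qed.

Lemma crel_real f a : P f a -> crel (fun t => (f t)%:C%C) a%:C%C.
Proof. by move=> Pf; split => //=; exact: rel_cst. Qed.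

Lemma crelD x y z w : crel x z -> crel y w -> crel (fun t => x t + y t) (z + w).
Proof.
move=> [x1 x2] [y1 y2]; split; rewrite raddfD /=.
  by under eq_fun do rewrite raddfD /=; exact: relD.
by under eq_fun do rewrite raddfD /=; exact: relD.
Qed.

Lemma crelM x y z w : crel x z -> crel y w -> crel (fun t => x t * y t) (z * w).
Proof.
have ReM (u v : R[i]) : complex.Re (u * v) =
    complex.Re u * complex.Re v - complex.Im u * complex.Im v by case: u v => ? ? [].
have ImM (u v : R[i]) : complex.Im (u * v) =
    complex.Re u * complex.Im v + complex.Im u * complex.Re v by case: u v => ? ? [].
move=> [x1 x2] [y1 y2]; split; rewrite ?ReM ?ImM.
  by under eq_fun do rewrite ReM; apply: relB; exact: relM.
by under eq_fun do rewrite ImM; apply: relD; exact: relM.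
Qed.

Lemma crelN x z : crel x z -> crel (fun t => - x t) (- z).
Proof.
move=> [x1 x2]; split; rewrite raddfN /=.
  by under eq_fun do rewrite raddfN /=; exact: relN.
by under eq_fun do rewrite raddfN /=; exact: relN.
Qed.

Lemma crel_conj x z : crel x z -> crel (fun t => (x t)^*) z^*.
Proof.
have ReC (u : R[i]) : complex.Re u^* = complex.Re u by case: u.
have ImC (u : R[i]) : complex.Im u^* = - complex.Im u by case: u.
move=> [x1 x2]; split; rewrite ?ReC ?ImC.
  by under eq_fun do rewrite ReC.
by under eq_fun do rewrite ImC; exact: relN.
Qed.

Lemma crel_sum (I : Type) (r : seq I) (x : I -> T -> R[i]) (z : I -> R[i]) :
  (forall i, crel (x i) (z i)) ->
  crel (fun t => \sum_(i <- r) x i t) (\sum_(i <- r) z i).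
Proof.
move=> Px; elim: r => [|i r IH].
  by under eq_fun do rewrite big_nil; rewrite big_nil; exact: crel_cst.
by under eq_fun do rewrite big_cons; rewrite big_cons; exact: crelD.
Qed.

Variable n : nat.
Local Notation M := 'M[R[i]]_n.

Definition mrel (X : T -> M) (A : M) := forall k l, crel (fun t => X t k l) (A k l).

Lemma mrel_cst A : mrel (fun=> A) A.
Proof. by move=> k l; exact: crel_cst. Qed.

Lemma mrelD X Y A B : mrel X A -> mrel Y B -> mrel (fun t => X t + Y t) (A + B).
Proof.
move=> XA YB k l; rewrite mxE; under eq_fun do rewrite mxE.
exact: crelD.
Qed.

Lemma mrelN X A : mrel X A -> mrel (fun t => - X t) (- A).
Proof.
move=> XA k l; rewrite mxE; under eq_fun do rewrite mxE.
exact: crelN.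
Qed.

Lemma mrelB X Y A B : mrel X A -> mrel Y B -> mrel (fun t => X t - Y t) (A - B).
Proof. by move=> XA /mrelN; exact: mrelD. Qed.

Lemma mrelM X Y A B : mrel X A -> mrel Y B -> mrel (fun t => X t *m Y t) (A *m B).
Proof.
move=> XA YB k l; rewrite mxE; under eq_fun do rewrite mxE.
by apply: crel_sum => j; exact: crelM.
Qed.

Lemma mrelZ x z X A : crel x z -> mrel X A -> mrel (fun t => x t *: X t) (z *: A).
Proof.
move=> xz XA k l; rewrite mxE; under eq_fun do rewrite mxE.
exact: crelM.
Qed.

Lemma mrel_adj X A : mrel X A -> mrel (fun t => (X t)^t*) (A^t*).
Proof.
move=> XA k l; rewrite !mxE; under eq_fun do rewrite !mxE.
exact: crel_conj.
Qed.

Lemma mrel_bracket X Y A B :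
  mrel X A -> mrel Y B -> mrel (fun t => bracket (X t) (Y t)) (bracket A B).
Proof. by move=> XA YB; apply: mrelB; exact: mrelM. Qed.

Lemma mrel_trace X A : mrel X A -> crel (fun t => \tr (X t)) (\tr A).
Proof. by move=> XA; apply: crel_sum => i. Qed.

Lemma rel_feedback H X Y G A B : mrel H G -> mrel X A -> mrel Y B ->
  P (fun t => feedback (H t) (X t) (Y t)) (feedback G A B).
Proof.
move=> HG XA YB; apply: (mrel_trace (mrelM (mrel_bracket _ XA) YB)).1.
by apply: mrelZ => //; exact: crel_cst.
Qed.

Lemma rel_distV X Y A B : mrel X A -> mrel Y B ->
  P (fun t => distV (X t) (Y t)) (distV A B).
Proof.
move=> XA YB; apply: relM; last exact: rel_cst.
have XY := mrelB XA YB; exact: (mrel_trace (mrelM XY XY)).1.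
Qed.

Definition sqnorm (A : M) : R :=
  \sum_(k < n) \sum_(l < n) (complex.Re (A k l) ^+ 2 + complex.Im (A k l) ^+ 2).

Lemma rel_sqnorm X A : mrel X A -> P (fun t => sqnorm (X t)) (sqnorm A).
Proof.
move=> XA; apply: rel_sum => k; apply: rel_sum => l.
by apply: relD; rewrite expr2; under eq_fun do rewrite expr2;
  apply: relM; apply XA.
Qed.

End RingRelation.

Lemma cvg_ring_relation (R : realType) (T : Type) (F : set_system T) :
  Filter F -> ring_relation (fun (f : T -> R) a => f @ F --> a).
Proof.
move=> FF; split=> [c|f g a b|f g a b]; first exact: cvg_cst.
  exact: cvgD.
exact: cvgM.
Qed.

Section BoundedLipschitz.
Context {R : realType} {T : Type} (d : T -> T -> R).
Hypothesis d_ge0 : forall s t, 0 <= d s t.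

(** With [d] constantly 1 the last clause follows from boundedness, up to the constant, so the same
    calculus also yields plain boundedness. *)
Definition bounded_Lipschitz (f : T -> R) := exists K, [/\ 0 <= K,
  forall t, `|f t| <= K & forall s t, `|f t - f s| <= K * d s t].

Lemma bounded_Lipschitz_ring_relation :
  ring_relation (fun f (_ : R) => bounded_Lipschitz f).
Proof.
split=> [c|f g _ _ [K [K0 fK fL]] [L [L0 gL gL']]|f g _ _ [K [K0 fK fL]] [L [L0 gL gL']]].
- by exists `|c|; split=> // s t; rewrite subrr normr0 mulr_ge0.
- exists (K + L); split=> [|t|s t]; first exact: addr_ge0.
    by apply: le_trans (ler_normD _ _) _; exact: lerD.
  have -> : f t + g t - (f s + g s) = (f t - f s) + (g t - g s) by ring.
  by rewrite mulrDl; apply: le_trans (ler_normD _ _) _; exact: lerD.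
exists (2 * (K * L)); split=> [|t|s t]; first by rewrite !mulr_ge0.
  rewrite normrM; apply: le_trans (ler_pM _ _ (fK t) (gL t)) _ => //.
  by rewrite ler_peMl ?mulr_ge0 // ler1n.
have -> : f t * g t - f s * g s = f t * (g t - g s) + (f t - f s) * g s by ring.
apply: le_trans (ler_normD _ _) _; rewrite !normrM.
have -> : 2 * (K * L) * d s t = K * (L * d s t) + (K * d s t) * L by ring.
by apply: lerD; apply: ler_pM.
Qed.

End BoundedLipschitz.

(** * Derivatives of complex-valued and matrix-valued curves *)

Section ComplexDerivative.
Context {R : realType}.
Implicit Types (t : R) (x y : R -> R[i]).

(** Leibniz's rule involves the values of the factors, so derivatives do not form a [ring_relation]
    and get their own calculus. *)
Definition cder t x (v : R[i]) :=
  is_derive t (1 : R) (fun s => complex.Re (x s)) (complex.Re v) /\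
  is_derive t (1 : R) (fun s => complex.Im (x s)) (complex.Im v).

Lemma cder_cst t (z : R[i]) : cder t (fun=> z) 0.
Proof. by split; exact: is_derive_cst. Qed.

Lemma cderD t x y v w : cder t x v -> cder t y w -> cder t (fun s => x s + y s) (v + w).
Proof.
move=> [x1 x2] [y1 y2]; split; rewrite raddfD /=.
  by under eq_fun do rewrite raddfD /=; exact: is_deriveD.
by under eq_fun do rewrite raddfD /=; exact: is_deriveD.
Qed.

Lemma cder_conj t x v : cder t x v -> cder t (fun s => (x s)^*) v^*.
Proof.
have ReC (u : R[i]) : complex.Re u^* = complex.Re u by case: u.
have ImC (u : R[i]) : complex.Im u^* = - complex.Im u by case: u.
move=> [x1 x2]; split; rewrite ?ReC ?ImC.
  by under eq_fun do rewrite ReC.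
by under eq_fun do rewrite ImC; exact: is_deriveN.
Qed.

Lemma cderM t x y v w : cder t x v -> cder t y w ->
  cder t (fun s => x s * y s) (v * y t + x t * w).
Proof.
have ReM (a b : R[i]) : complex.Re (a * b) =
    complex.Re a * complex.Re b - complex.Im a * complex.Im b by case: a b => ? ? [].
have ImM (a b : R[i]) : complex.Im (a * b) =
    complex.Re a * complex.Im b + complex.Im a * complex.Re b by case: a b => ? ? [].
move=> [x1 x2] [y1 y2]; split; rewrite raddfD /= ?ReM ?ImM.
  under eq_fun do rewrite ReM.
  have := is_deriveB (is_deriveM x1 y1) (is_deriveM x2 y2).
  by move/is_derive_eq; apply; rewrite /GRing.scale /=; ring.
under eq_fun do rewrite ImM.
have := is_deriveD (is_deriveM x1 y2) (is_deriveM x2 y1).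
by move/is_derive_eq; apply; rewrite /GRing.scale /=; ring.
Qed.

Lemma cder_sum t (I : Type) (r : seq I) (x : I -> R -> R[i]) (v : I -> R[i]) :
  (forall i, cder t (x i) (v i)) ->
  cder t (fun s => \sum_(i <- r) x i s) (\sum_(i <- r) v i).
Proof.
move=> Px; elim: r => [|i r IH].
  by under eq_fun do rewrite big_nil; rewrite big_nil; exact: cder_cst.
by under eq_fun do rewrite big_cons; rewrite big_cons; exact: cderD.
Qed.

Variable n : nat.
Local Notation M := 'M[R[i]]_n.
Implicit Types (X Y V W : R -> M) (A B : M).

Definition mder t X A := forall k l, cder t (fun s => X s k l) (A k l).

Lemma mder_cst t A : mder t (fun=> A) 0.
Proof. by move=> k l; rewrite mxE; exact: cder_cst. Qed.

Lemma mderD t X Y A B : mder t X A -> mder t Y B -> mder t (fun s => X s + Y s) (A + B).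
Proof.
move=> XA YB k l; rewrite mxE; under eq_fun do rewrite mxE.
exact: cderD.
Qed.

Lemma mderM t X Y A B : mder t X A -> mder t Y B ->
  mder t (fun s => X s *m Y s) (A *m Y t + X t *m B).
Proof.
move=> XA YB k l; rewrite !mxE; under eq_fun do rewrite mxE.
by rewrite -big_split; apply: cder_sum => j; exact: cderM.
Qed.

Lemma mder_adj t X A : mder t X A -> mder t (fun s => (X s)^t*) (A^t*).
Proof.
move=> XA k l; rewrite !mxE; under eq_fun do rewrite !mxE.
exact: cder_conj.
Qed.

Lemma mder_trace t X A : mder t X A -> cder t (fun s => \tr (X s)) (\tr A).
Proof. by move=> XA; apply: cder_sum => i. Qed.

Definition mx_hcont X := forall t, 0 <= t ->
  mrel (fun (f : R -> R) a => f @ hnbhs t --> a) X (X t).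

Definition msol X V := mx_hcont X /\ forall t, 0 < t -> mder t X (V t).

Lemma has_velocityE X V : has_velocity `[0, +oo[ X V <-> msol X V.
Proof.
have int0 t : (`[0, +oo[%classic : set R)^° t <-> 0 < t.
  by rewrite interior_itv /= in_itv /= andbT.
split=> [H|[cX dX] k l].
  split=> [t t0 k l|t /int0 t0 k l]; last by have [_ _ D] := H k l; exact: (D t t0).
  by have [/hcontE C1 /hcontE C2 _] := H k l; split; [exact: C1|exact: C2].
split.
- by apply/hcontE => t t0; exact: (cX t t0 k l).1.
- by apply/hcontE => t t0; exact: (cX t t0 k l).2.
- by move=> t /int0 t0; exact: (dX t t0 k l).
Qed.

Lemma msol_ext X V W : msol X V -> (forall t, 0 < t -> V t = W t) -> msol X W.
Proof. by move=> [cX dX] VW; split=> // t t0; rewrite -VW //; exact: dX. Qed.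

Lemma msol_ReE X V k l : msol X V ->
  hder (fun t => complex.Re (X t k l)) (fun t => complex.Re (V t k l)).
Proof. by move=> [cX dX]; split=> t t0; [apply: (cX t t0 k l).1|apply: (dX t t0 k l).1]. Qed.

Lemma msol_ImE X V k l : msol X V ->
  hder (fun t => complex.Im (X t k l)) (fun t => complex.Im (V t k l)).
Proof. by move=> [cX dX]; split=> t t0; [apply: (cX t t0 k l).2|apply: (dX t t0 k l).2]. Qed.

Lemma msolM X Y V W : msol X V -> msol Y W ->
  msol (fun t => X t *m Y t) (fun t => V t *m Y t + X t *m W t).
Proof.
move=> [cX dX] [cY dY]; split=> t t0; last by apply: mderM; [exact: dX|exact: dY].
by apply: mrelM; [exact: cvg_ring_relation|exact: cX|exact: cY].
Qed.

Lemma msolD X Y V W : msol X V -> msol Y W ->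
  msol (fun t => X t + Y t) (fun t => V t + W t).
Proof.
move=> [cX dX] [cY dY]; split=> t t0; last by apply: mderD; [exact: dX|exact: dY].
by apply: mrelD; [exact: cvg_ring_relation|exact: cX|exact: cY].
Qed.

Lemma msol_adj X V : msol X V -> msol (fun t => (X t)^t*) (fun t => (V t)^t*).
Proof.
move=> [cX dX]; split=> t t0; last by apply: mder_adj; exact: dX.
by apply: mrel_adj; [exact: cvg_ring_relation|exact: cX].
Qed.

Lemma msol_cst A : msol (fun=> A) (fun=> 0).
Proof.
split=> t t0; last exact: mder_cst.
by apply: mrel_cst; exact: cvg_ring_relation.
Qed.

Lemma msol_trace X V : msol X V ->
  hder (fun t => complex.Re (\tr (X t))) (fun t => complex.Re (\tr (V t))).
Proof.
move=> [cX dX]; split=> t t0; last by have [] := mder_trace (dX t t0).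
by apply: (mrel_trace _ (cX t t0)).1; exact: cvg_ring_relation.
Qed.

Lemma msol_eq0 X V : msol X V -> (forall t, 0 < t -> V t = 0) ->
  forall t, 0 <= t -> X t = X 0.
Proof.
move=> dX V0 t t0; apply/matrixP => k l; apply/eqP; rewrite eq_complex.
apply/andP; split; apply/eqP.
  by rewrite (hder_eq0 (msol_ReE k l dX) _ t0) // => s /V0 ->; rewrite mxE.
by rewrite (hder_eq0 (msol_ImE k l dX) _ t0) // => s /V0 ->; rewrite mxE.
Qed.

End ComplexDerivative.

(** * The interaction picture *)

Section FreeEvolution.
Context {R : realType}.

Definition cis (x : R) : R[i] := (cos x +i* sin x)%C.

Lemma cisD x y : cis (x + y) = cis x * cis y.
Proof. by rewrite /cis cosD sinD; congr (_ +i* _)%C; rewrite addrC; ring. Qed.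

Lemma cis0 : cis 0 = 1.
Proof. by rewrite /cis cos0 sin0. Qed.

Lemma cisN x : cis (- x) = (cis x)^*.
Proof. by rewrite /cis cosN sinN. Qed.

Lemma cder_cis (w t : R) : cder t (fun s => cis (w * s)) ('i%C * w%:C%C * cis (w * t)).
Proof.
have D1 : is_derive t (1 : R) (fun s => w * s) w.
  have := is_deriveZ w (is_derive_id t (1 : R)).
  by move/is_derive_eq; apply; rewrite /GRing.scale /= mulr1.
split.
  have := @is_derive1_comp _ cos (fun s => w * s) t _ _ (is_derive_cos (w * t)) D1.
  by move/is_derive_eq; apply; rewrite /=; ring.
have := @is_derive1_comp _ sin (fun s => w * s) t _ _ (is_derive_sin (w * t)) D1.
by move/is_derive_eq; apply; rewrite /=; ring.
Qed.

(** The halved exponents follow the shape of the coefficients of the cosine and sine series, to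
    which [expmx_diag_hamiltonian] reduces the exponential. *)
Lemma imaginary_exp (x : R) m : (0 +i* x)%C ^+ m =
  ((~~ odd m)%:R * (-1) ^+ m./2 * x ^+ m +i* ((odd m)%:R * (-1) ^+ m.-1./2 * x ^+ m))%C.
Proof.
elim: m => [|m IH]; first by rewrite !expr0 /= !mulr1.
rewrite exprS IH /= uphalfE; apply/eqP; rewrite eq_complex /=; apply/andP.
have := odd_double_half m; case: (odd m) => /= Em; rewrite /= -Em ?doubleK /=.
  rewrite !add0n -doubleS ?doubleK !mul1r !mul0r; split; apply/eqP.
    by rewrite !exprS; ring.
  by ring.
split; apply/eqP; rewrite !exprS; ring.
Qed.

Variable n : nat.
Local Notation M := 'M[R[i]]_n.
Variable a : 'rV[R]_n.
Local Notation H0 := (diag_hamiltonian a).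

Lemma expmx_diag_hamiltonian (t : R) :
  expmx (('i%C * t%:C%C) *: H0) = diag_mx (\row_k cis (a 0 k * t)).
Proof.
have E m : (('i%C * t%:C%C) *: H0) ^+ m = diag_mx (\row_k (0 +i* (a 0 k * t))%C ^+ m).
  elim: m => [|m IH].
    by rewrite expr0; apply/matrixP => k l; rewrite !mxE expr0.
  rewrite exprS IH; apply/matrixP => k l; rewrite !mxE (bigD1 k) //= !mxE eqxx mulr1n.
  rewrite big1 ?addr0; last by move=> j jk; rewrite !mxE eq_sym (negbTE jk) mulr0n mulr0 mul0r.
  rewrite exprS -mulrnAr; congr (_ * _).
  by apply/eqP; rewrite eq_complex /= !(mulr0, mul0r, mul1r, subr0, addr0, add0r, oppr0) mulrC !eqxx.
have lim0 : limn (series (fun m : nat => 0 / m`!%:R) : nat -> R) = 0.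
  apply/cvg_lim => //; rewrite (_ : series _ = fun=> 0); first exact: cvg_cst.
  by apply/funext => m; rewrite /series /= big1 // => j _; rewrite mul0r.
apply/matrixP => k l; rewrite !mxE.
under eq_fun do rewrite E !mxE imaginary_exp.
under [X in (_ +i* limn (series X))%C]eq_fun do rewrite E !mxE imaginary_exp.
have [_|_] := eqVneq k l; last by rewrite !mulr0n /= !lim0.
rewrite !mulr1n /= /cis; congr (_ +i* _)%C.
  by rewrite unlock; congr (limn (series _)); apply/funext => m; rewrite cos_coeffE !mulrA.
by rewrite unlock; congr (limn (series _)); apply/funext => m; rewrite sin_coeffE !mulrA.
Qed.

(* Locked, since [mxE] would otherwise unfold it. *)
Definition twist (X : M) (t : R) : M :=
  locked (\matrix_(k, l) (cis ((a 0 l - a 0 k) * t) * X k l)).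
Local Notation tw := twist.

Lemma twistE X t k l : tw X t k l = cis ((a 0 l - a 0 k) * t) * X k l.
Proof. by rewrite /twist -lock mxE. Qed.

Lemma free_evolutionE X : free_evolution H0 X = tw X.
Proof.
apply/funext => t; rewrite /free_evolution.
have -> : - ('i%C * t%:C%C) = 'i%C * (- t)%:C%C :> R[i] by rewrite rmorphN mulrN.
rewrite !expmx_diag_hamiltonian -mulmxA mul_diag_mx mul_mx_diag.
apply/matrixP => k l; rewrite twistE !mxE mulrCA mulrC.
by rewrite -cisD; congr (cis _ * _); ring.
Qed.

Lemma twist0 X : tw X 0 = X.
Proof. by apply/matrixP => k l; rewrite twistE mulr0 cis0 mul1r. Qed.

Lemma twist_comp X s t : tw (tw X s) t = tw X (s + t).
Proof. by apply/matrixP => k l; rewrite !twistE mulrA -cisD mulrDr addrC. Qed.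

Lemma twistK X t : tw (tw X t) (- t) = X.
Proof. by rewrite twist_comp subrr twist0. Qed.

Lemma twistNK X t : tw (tw X (- t)) t = X.
Proof. by rewrite twist_comp addNr twist0. Qed.

Lemma twistD X Y t : tw (X + Y) t = tw X t + tw Y t.
Proof. by apply/matrixP => k l; rewrite mxE !twistE mxE mulrDr. Qed.

Lemma twistN X t : tw (- X) t = - tw X t.
Proof. by apply/matrixP => k l; rewrite mxE !twistE mxE mulrN. Qed.

Lemma twistB X Y t : tw (X - Y) t = tw X t - tw Y t.
Proof. by rewrite twistD twistN. Qed.

Lemma twistZ z X t : tw (z *: X) t = z *: tw X t.
Proof. by apply/matrixP => k l; rewrite mxE !twistE mxE mulrCA. Qed.

Lemma twistM X Y t : tw (X *m Y) t = tw X t *m tw Y t.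
Proof.
apply/matrixP => k l; rewrite twistE !mxE mulr_sumr.
apply: eq_bigr => j _; rewrite !twistE mulrACA -cisD.
by congr (cis _ * _); ring.
Qed.

Lemma twist_bracket X Y t : tw (bracket X Y) t = bracket (tw X t) (tw Y t).
Proof. by rewrite /bracket twistB !twistM. Qed.

Lemma twist_tr X t : \tr (tw X t) = \tr X.
Proof.
by apply: eq_bigr => k _; rewrite twistE subrr mul0r cis0 mul1r.
Qed.

Lemma twist_adj X t : (tw X t)^t* = tw (X^t*) t.
Proof.
apply/matrixP => k l; rewrite !mxE !twistE !mxE rmorphM /= -cisN.
by congr (cis _ * _); ring.
Qed.

Lemma twist_hamiltonian t : tw H0 t = H0.
Proof.
apply/matrixP => k l; rewrite twistE !mxE.
by have [->|] := eqVneq k l; rewrite ?mulr0n ?mulr0 // subrr mul0r cis0 mul1r.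
Qed.

Lemma twist_sqnorm X t : sqnorm (tw X t) = sqnorm X.
Proof.
apply: eq_bigr => k _; apply: eq_bigr => l _; rewrite twistE.
case: (X k l) => x y; set w := _ * t; rewrite /cis /=.
transitivity ((cos w ^+ 2 + sin w ^+ 2) * (x ^+ 2 + y ^+ 2)); first by ring.
by rewrite cos2Dsin2 mul1r.
Qed.

Lemma twist_distV X Y t : distV (tw X t) (tw Y t) = distV X Y.
Proof.
have E (Z : M) : Z ^+ 2 = Z *m Z by [].
by rewrite /distV -twistB !E -twistM twist_tr.
Qed.

Lemma twist_feedback H X Y t :
  feedback (tw H t) (tw X t) (tw Y t) = feedback H X Y.
Proof.
by rewrite /feedback -twistZ -twist_bracket -twistM twist_tr.
Qed.

Lemma bracket_hamiltonianE X k l : bracket H0 X k l = (a 0 k - a 0 l)%:C%C * X k l.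
Proof.
by rewrite /bracket mul_diag_mx mul_mx_diag !mxE rmorphB mulrBl [X k l * _]mulrC.
Qed.

Lemma cder_phase (w e t : R) :
  cder t (fun s => cis (w * (e * s))) ('i%C * (w * e)%:C%C * cis (w * (e * t))).
Proof. by under eq_fun do rewrite mulrA; rewrite mulrA; exact: cder_cis. Qed.

(** The factor [e] covers both passages: [e = -1] leads to the interaction picture, [e = 1] back
    from it. *)
Lemma mder_twist (X : R -> M) (A : M) (e t : R) : mder t X A ->
  mder t (fun s => tw (X s) (e * s))
    (tw A (e * t) - (e%:C%C * 'i%C) *: bracket H0 (tw (X t) (e * t))).
Proof.
move=> dX k l.
rewrite (_ : (fun s => _) = fun s => cis ((a 0 l - a 0 k) * (e * s)) * X s k l);
  last by apply/funext => s; rewrite twistE.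
have := cderM (cder_phase (a 0 l - a 0 k) e t) (dX k l).
have E (B C : M) (z : R[i]) : (B - z *: C) k l = B k l - z * C k l by rewrite !mxE.
rewrite E bracket_hamiltonianE !twistE.
move=> D; rewrite (_ : _ - _ = 'i%C * ((a 0 l - a 0 k) * e)%:C%C *
  cis ((a 0 l - a 0 k) * (e * t)) * X t k l + cis ((a 0 l - a 0 k) * (e * t)) * A k l) //.
by rewrite rmorphM rmorphB /=; ring.
Qed.

Lemma msol_twist (X V : R -> M) (e : R) : msol X V ->
  msol (fun t => tw (X t) (e * t))
    (fun t => tw (V t) (e * t) - (e%:C%C * 'i%C) *: bracket H0 (tw (X t) (e * t))).
Proof.
move=> [cX dX]; split=> t t0; last by apply: mder_twist; exact: dX.
move=> k l; rewrite /= twistE.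
rewrite (_ : (fun s => _) = fun s => cis ((a 0 l - a 0 k) * (e * s)) * X s k l);
  last by apply/funext => s; rewrite twistE.
apply: crelM; [exact: cvg_ring_relation| |exact: cX].
have [D1 D2] := cder_phase (a 0 l - a 0 k) e t.
by split; apply: cvg_within_filter; apply: differentiable_continuous;
  apply/derivable1_diffP; apply: ex_derive.
Qed.

(* The equation of motion of [e^(i H0 t) rho(t) e^(- i H0 t)], whose target is constant. *)
Definition interaction (H1 rhod0 : M) (sigma : R -> M) := msol sigma (fun t =>
  (feedback (tw H1 (- t)) (sigma t) rhod0)%:C%C *: bracket (- 'i%C *: tw H1 (- t)) (sigma t)).

Lemma bracketZl (z : R[i]) (X Y : M) : bracket (z *: X) Y = z *: bracket X Y.
Proof. by rewrite /bracket -scalemxAl -scalemxAr scalerBr. Qed.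

Lemma bracketDl (X Y Z : M) : bracket (X + Y) Z = bracket X Z + bracket Y Z.
Proof. by rewrite /bracket mulmxDl mulmxDr opprD addrACA. Qed.

(** Twisting by [- t] adds [i [H0, .]] to the velocity, which cancels the drift; the feedback is
    unchanged because it is invariant under a common twist of its three arguments. *)
Lemma controlledE (H1 rhod0 : M) (rho : R -> M) :
  controlled `[0, +oo[ H0 H1 rho (free_evolution H0 rhod0) <->
  interaction H1 rhod0 (fun t => tw (rho t) (- t)).
Proof.
have fb t : feedback (tw H1 (- t)) (tw (rho t) (- t)) rhod0 = feedback H1 (rho t) (tw rhod0 t).
  by rewrite -(twist_feedback H1 (rho t) (tw rhod0 t) (- t)) twistK.
rewrite free_evolutionE /controlled has_velocityE; split.
  move=> /(msol_twist (-1)).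
  rewrite (_ : (fun t => tw (rho t) (-1 * t)) = fun t => tw (rho t) (- t)); last first.
    by apply/funext => t; rewrite mulN1r.
  move/msol_ext; apply => t _; rewrite !mulN1r fb.
  rewrite twistZ twist_bracket twistD twist_hamiltonian.
  rewrite twistZ bracketDl !bracketZl scalerDr !scalerA.
  rewrite (_ : (-1)%:C%C * 'i%C = - 'i%C :> R[i]); last by rewrite rmorphN rmorph1 mulN1r.
  by rewrite addrAC subrr add0r mulrC.
move=> /(msol_twist 1); rewrite (_ : (fun t => tw _ (1 * t)) = rho); last first.
  by apply/funext => t; rewrite mul1r twistNK.
move/msol_ext; apply => t _; rewrite !mul1r fb twistNK.
rewrite twistZ twist_bracket twistZ !twistNK.
rewrite bracketDl !bracketZl [RHS]scalerDr [RHS]addrC [X in _ = _ + X]scaleNr.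
by rewrite scalerA mulrC -scalerA.
Qed.

End FreeEvolution.

Section Adjoint.
Context {R : realType} {n : nat}.
Implicit Types A B : 'M[R[i]]_n.

Lemma adjmxM A B : (A *m B)^t* = B^t* *m A^t*.
Proof. by rewrite trmx_mul map_mxM. Qed.

Lemma adjmxZ (z : R[i]) A : (z *: A)^t* = z^* *: A^t*.
Proof. by apply/matrixP => k l; rewrite !mxE rmorphM. Qed.

Lemma adjmxD A B : (A + B)^t* = A^t* + B^t*.
Proof. by apply/matrixP => k l; rewrite !mxE rmorphD. Qed.

Lemma adjmxN A : (- A)^t* = - A^t*.
Proof. by apply/matrixP => k l; rewrite !mxE rmorphN. Qed.

Lemma adjmx1 : (1%:M : 'M[R[i]]_n)^t* = 1%:M.
Proof. by rewrite trmx1 map_scalar_mx rmorph1. Qed.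

Lemma adjmxK A : A^t*^t* = A.
Proof. exact: trmxCK. Qed.

Lemma adjmx_bracket A B : (bracket A B)^t* = bracket (B^t*) (A^t*).
Proof. by rewrite /bracket adjmxD adjmxN !adjmxM. Qed.

End Adjoint.

(** * Unitary propagators of antihermitian fields *)

Section Propagator.
Context {R : realType} {n : nat}.
Local Notation M := 'M[R[i]]_n.
Local Notation I := ('I_n * 'I_n * bool)%type.
Implicit Types (x y : I -> R) (A B W X : M).

Definition mx_of x : M := \matrix_(k, l) (x (k, l, false) +i* x (k, l, true))%C.

Definition coords A (j : I) : R :=
  if j.2 then complex.Im (A j.1.1 j.1.2) else complex.Re (A j.1.1 j.1.2).

Lemma coordsK A : mx_of (coords A) = A.
Proof. by apply/matrixP => k l; rewrite mxE /coords /=; case: (A k l). Qed.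

Definition sqsum x : R := \sum_j x j ^+ 2.

Lemma sqsum_ge0 x : 0 <= sqsum x.
Proof. by apply: sumr_ge0 => j _; exact: sqr_ge0. Qed.

Lemma sqnorm_trace A : sqnorm A = complex.Re (\tr (A^t* *m A)).
Proof.
rewrite /sqnorm exchange_big raddf_sum; apply: eq_bigr => l _.
rewrite mxE raddf_sum; apply: eq_bigr => k _; rewrite !mxE.
by case: (A k l) => u v /=; ring.
Qed.

Lemma sqsum_mx_of x : sqsum x = sqnorm (mx_of x).
Proof.
rewrite /sqsum /sqnorm pair_bigA /= -[RHS]/(\sum_i _).
transitivity (\sum_(p : 'I_n * 'I_n) \sum_(b : bool) x (p, b) ^+ 2).
  by rewrite pair_bigA /=; apply: eq_bigr => -[p b] _.
by apply: eq_bigr => -[k l] _; rewrite big_bool /= mxE /= addrC.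
Qed.

Definition dist_tx (p q : R * (I -> R)) : R := `|q.1 - p.1| + \sum_j `|q.2 j - p.2 j|.

Lemma dist_tx_ge0 p q : 0 <= dist_tx p q.
Proof. by rewrite addr_ge0 // sumr_ge0. Qed.

(* Agrees with [mx_of] where [sqsum x = n], in particular at unitary matrices. *)
Definition cutoff x : M := ((1 + n%:R) / (1 + sqsum x))%:C%C *: mx_of x.

(** The difference of two quotients splits into a part where the numerator varies and one where the
    denominator does; products of two coordinates are dominated by [1 + sqsum x]. *)
Lemma cutoff_coord_Lipschitz (j : I) :
  bounded_Lipschitz dist_tx (fun p => p.2 j / (1 + sqsum p.2)).
Proof.
have pos x : 0 < 1 + sqsum x by rewrite ltr_wpDr ?sqsum_ge0.
have le_sq x i : x i ^+ 2 <= sqsum x.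
  by rewrite /sqsum (bigD1 i) //= lerDl sumr_ge0 // => k _; exact: sqr_ge0.
have mid x i k : `|x i| * `|x k| <= 1 + sqsum x.
  have := le_sq x i; have := le_sq x k.
  rewrite -[x i ^+ 2]real_normK ?num_real // -[x k ^+ 2]real_normK ?num_real //.
  by have := sqr_ge0 (`|x i| - `|x k|); nra.
have small x i : `|x i| <= 1 + sqsum x.
  have := le_sq x i; rewrite -[x i ^+ 2]real_normK ?num_real //.
  by have := sqr_ge0 (`|x i| - 1); nra.
(* The Lipschitz constant is 1 from the numerator plus 2 from the denominator. *)
exists 3; split=> // [p|p q].
  rewrite normrM normfV (gtr0_norm (pos _)) ler_pdivrMr //.
  by have := small p.2 j; have := pos p.2; lra.
set x := p.2; set y := q.2.
have -> : y j / (1 + sqsum y) - x j / (1 + sqsum x) =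
    (y j - x j) / (1 + sqsum y) + x j * (sqsum x - sqsum y) / ((1 + sqsum x) * (1 + sqsum y)).
  by field; rewrite !gt_eqF.
have dS : `|x j * (sqsum x - sqsum y)| <=
    (\sum_i `|y i - x i|) * (2 * ((1 + sqsum x) * (1 + sqsum y))).
  rewrite normrM -sumrB mulr_suml.
  apply: le_trans (ler_wpM2l (normr_ge0 _) (ler_norm_sum _ _ _)) _.
  rewrite mulr_sumr; apply: ler_sum => i _.
  rewrite subr_sqr normrM mulrCA distrC ler_wpM2l //.
  apply: le_trans (ler_wpM2l (normr_ge0 _) (ler_normD _ _)) _.
  have A1 := mid x j i; have A2 := ler_pM (normr_ge0 _) (normr_ge0 _) (small x j) (small y i).
  have A3 := pos x; have A4 := sqsum_ge0 y; nra.
apply: le_trans (ler_normD _ _) _.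
have A1 : `|(y j - x j) / (1 + sqsum y)| <= \sum_i `|y i - x i|.
  rewrite normrM normfV (gtr0_norm (pos _)) ler_pdivrMr //.
  apply: (@le_trans _ _ (\sum_i `|y i - x i|)).
    by rewrite (bigD1 j) //= lerDl sumr_ge0.
  by rewrite ler_peMr ?sumr_ge0 // lerDl sqsum_ge0.
have A2 : `|x j * (sqsum x - sqsum y) / ((1 + sqsum x) * (1 + sqsum y))| <=
    (\sum_i `|y i - x i|) * 2.
  have P : 0 < (1 + sqsum x) * (1 + sqsum y) by rewrite mulr_gt0.
  by rewrite normrM normfV (gtr0_norm P) ler_pdivrMr // -mulrA.
by rewrite /dist_tx -/x -/y; have := normr_ge0 (q.1 - p.1); lra.
Qed.

(* The limit argument of [mrel] is a dummy here. *)
Definition Lipmx {T : Type} (d : T -> T -> R) (X : T -> M) :=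
  mrel (fun f (_ : R) => bounded_Lipschitz d f) X 0.

Lemma LipmxE {T : Type} (d : T -> T -> R) (X : T -> M) A :
  mrel (fun f (_ : R) => bounded_Lipschitz d f) X A -> Lipmx d X.
Proof. by []. Qed.

Lemma cutoff_Lipmx : Lipmx dist_tx (fun p => cutoff p.2).
Proof.
have rP := bounded_Lipschitz_ring_relation dist_tx_ge0.
have E x k l : cutoff x k l = ((1 + n%:R) * (x (k, l, false) / (1 + sqsum x)) +i*
    ((1 + n%:R) * (x (k, l, true) / (1 + sqsum x))))%C.
  rewrite !mxE; apply/eqP; rewrite eq_complex /= !mul0r subr0 addr0.
  by apply/andP; split; apply/eqP; ring.
move=> k l; split; under eq_fun do rewrite E /=.
  apply: (relM rP (a := 0) (b := 0)); first exact: (rel_cst rP).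
  exact: cutoff_coord_Lipschitz.
apply: (relM rP (a := 0) (b := 0)); first exact: (rel_cst rP).
exact: cutoff_coord_Lipschitz.
Qed.

(** The field is evaluated at [cutoff], which makes it bounded Lipschitz and so gives a global
    solution. As [cutoff] is a real multiple of [W] and [A] is antihermitian, [W^t* *m W] is
    conserved; the solution stays unitary, where the cutoff is invisible. *)
Theorem unitary_ode (A : R -> M -> M) :
  Lipmx dist_tx (fun p => A p.1 (cutoff p.2)) ->
  (forall t W, (A t W)^t* = - A t W) ->
  exists W : R -> M, [/\ W 0 = 1%:M, forall t, 0 <= t -> (W t)^t* *m W t = 1%:M &
    msol W (fun t => A t (W t) *m W t)].
Proof.
move=> AL Aah; have rP := bounded_Lipschitz_ring_relation dist_tx_ge0.
pose Fm (p : R * (I -> R)) := A p.1 (cutoff p.2) *m cutoff p.2.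
have FmL : Lipmx dist_tx Fm by apply: (LipmxE (mrelM rP AL cutoff_Lipmx)).
pose F t x (j : I) := coords (Fm (t, x)) j.
have /choice[K HK] (j : I) : exists K, [/\ 0 <= K, forall t x, `|F t x j| <= K &
    forall t s x y, `|F t x j - F s y j| <= K * (`|t - s| + \sum_i `|x i - y i|)].
  case: j => -[k l] b; have [[K1 [P1 B1 L1]] [K2 [P2 B2 L2]]] := FmL k l.
  rewrite /F /coords /=; case: b.
    exists K2; split=> [//|t x|t s x y]; [exact: (B2 (t, x))|exact: (L2 (s, y) (t, x))].
  exists K1; split=> [//|t x|t s x y]; [exact: (B1 (t, x))|exact: (L1 (s, y) (t, x))].
have KS j : K j <= \sum_i K i.
  by rewrite (bigD1 j) //= lerDl sumr_ge0 // => i _; have [] := HK i.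
have FB t x j : `|F t x j| <= \sum_i K i.
  by have [_ /(_ t x) /le_trans + _] := HK j; exact.
have FL t s x y j : `|F t x j - F s y j| <= (\sum_i K i) * (`|t - s| + \sum_i `|x i - y i|).
  have [_ _ /(_ t s x y) /le_trans +] := HK j; apply.
  by rewrite ler_wpM2r // addr_ge0 // sumr_ge0.
have [x [x0 dx]] := bounded_Lipschitz_ode FB FL (coords 1%:M).
pose W t := mx_of (x t).
have dW : msol W (fun t => Fm (t, x t)).
  split=> t t0 k l; split; rewrite /W.
  - by rewrite mxE /=; under eq_fun do rewrite mxE /=; exact: (dx (k, l, false)).1.
  - by rewrite mxE /=; under eq_fun do rewrite mxE /=; exact: (dx (k, l, true)).1.
  - by under eq_fun do rewrite mxE /=; exact: (dx (k, l, false)).2.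
  - by under eq_fun do rewrite mxE /=; exact: (dx (k, l, true)).2.
have W0 : W 0 = 1%:M.
  by rewrite -[RHS]coordsK; congr mx_of; apply/funext => j; exact: x0.
have WW t : 0 <= t -> (W t)^t* *m W t = 1%:M.
  move=> t0; rewrite (msol_eq0 (msolM (msol_adj dW) dW) _ t0) => [|s s0].
    by rewrite W0 trmx1 map_scalar_mx /= rmorph1 mulmx1.
  pose c := ((1 + n%:R) / (1 + sqsum (x s)))%:C%C.
  have -> : Fm (s, x s) = c *: (A s (cutoff (x s)) *m W s).
    by rewrite /Fm /= [X in _ *m X]/cutoff -scalemxAr.
  rewrite adjmxZ adjmxM Aah.
  rewrite mulmxN -scalemxAl -scalemxAr mulNmx mulmxA.
  have -> : c^* = c by rewrite /c -[LHS]/(conjc _) conjc_real.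
  by rewrite scalerN addNr.
exists W; split=> //; apply: msol_ext dW _ => t t0; rewrite /Fm /=.
suff -> : cutoff (x t) = W t by [].
rewrite /cutoff sqsum_mx_of sqnorm_trace -/(W t) WW ?ltW // mxtrace1.
rewrite (_ : complex.Re n%:R = n%:R); last by rewrite raddfMn.
by rewrite divff ?scale1r // gt_eqF // ltr_wpDr.
Qed.

End Propagator.

(** * Unitary conjugation and the isospectral manifold *)

Section Isospectral.
Context {R : realType} {n : nat}.
Local Notation M := 'M[R[i]]_n.
Implicit Types (A B U X : M).

Lemma unitary_mulVmx U : U *m U^t* = 1%:M -> U^t* *m U = 1%:M.
Proof. exact: mulmx1C. Qed.

Lemma char_poly_unitary U X : U *m U^t* = 1%:M ->
  char_poly (U *m X *m U^t*) = char_poly X.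
Proof.
move=> UU; rewrite /char_poly /char_poly_mx.
have PP : map_mx polyC U *m map_mx polyC (U^t*) = 1%:M.
  by rewrite -map_mxM UU map_scalar_mx.
have -> : 'X%:M - map_mx polyC (U *m X *m U^t*) =
    map_mx polyC U *m ('X%:M - map_mx polyC X) *m map_mx polyC (U^t*).
  rewrite !map_mxM mulmxBr mulmxBl scalar_mxC; congr (_ - _).
  by rewrite -mulmxA PP mulmx1.
by rewrite !det_mulmx mulrAC -det_mulmx PP det1 mul1r.
Qed.

Lemma hermsymmxP A : reflect (A^t* = A) (A \is hermsymmx).
Proof.
apply: (iffP idP) => [|AA]; first exact: hermsymmxE.
by apply/is_hermitianmxP; rewrite expr0 scale1r AA.
Qed.

Lemma sqnorm_entry A k l :
  complex.Re (A k l) ^+ 2 + complex.Im (A k l) ^+ 2 <= sqnorm A.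
Proof.
rewrite /sqnorm (bigD1 k) //= (bigD1 l) //= -addrA lerDl.
by apply: addr_ge0; apply: sumr_ge0 => ? _;
  [|apply: sumr_ge0 => ? _]; rewrite addr_ge0 ?sqr_ge0.
Qed.

Lemma isospectral_unitary A U X : U *m U^t* = 1%:M ->
  isospectral_manifold A X -> isospectral_manifold A (U *m X *m U^t*).
Proof.
move=> UU [[Xh Xp Xt] Xc]; split; last by rewrite char_poly_unitary.
split; last by rewrite mxtrace_mulC mulmxA unitary_mulVmx // mul1mx.
  apply/hermsymmxP; rewrite !adjmxM adjmxK mulmxA.
  by move/hermsymmxP : Xh => ->.
move=> u; have := Xp (U^t* *m u).
by rewrite trmx_mul map_mxM /= adjmxK !mulmxA.
Qed.

End Isospectral.

(** * Existence and invariants of solutions in the interaction picture *)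

Section InteractionPicture.
Context {R : realType} {n : nat}.
Local Notation M := 'M[R[i]]_n.
Variables (a : 'rV[R]_n) (H1 rhod0 : M).
Hypothesis H1_herm : H1 \is hermsymmx.
Local Notation Ht := (fun t => twist a H1 (- t)).
Local Notation dabs := (fun s t : R => `|t - s|).
Local Notation cst1 := (fun _ _ => (1 : R)).

(** The equation of motion reads [sigma' = [generator, sigma]]; the generator is antihermitian at
    every [X], as [unitary_ode] requires. *)
Definition generator (t : R) (X : M) : M :=
  (feedback (Ht t) X rhod0)%:C%C *: (- 'i%C *: Ht t).

Lemma twist_herm t : (Ht t)^t* = Ht t.
Proof. by rewrite twist_adj (hermsymmxE H1_herm). Qed.

Lemma generator_antiherm t X : (generator t X)^t* = - generator t X.
Proof.
rewrite /generator adjmxZ adjmxZ twist_herm -[(_%:C%C)^*]/(conjc _) conjc_real.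
rewrite -scalerN -[in RHS]scaleNr opprK.
have -> // : (- 'i%C : R[i])^* = 'i%C.
by apply/eqP; rewrite eq_complex /= oppr0 opprK !eqxx.
Qed.

Lemma Lipmx_sqnorm {T : Type} (X : T -> M) (N : R) :
  (forall t, sqnorm (X t) <= N) -> Lipmx cst1 X.
Proof.
move=> XN k l.
have le_sq t : complex.Re (X t k l) ^+ 2 + complex.Im (X t k l) ^+ 2 <= N.
  exact: le_trans (sqnorm_entry _ k l) (XN t).
have bd (f : T -> R) : (forall t, f t ^+ 2 <= N) -> bounded_Lipschitz cst1 f.
  move=> fN; have f1 t : `|f t| <= 1 + N.
    have := fN t; rewrite -[f t ^+ 2]real_normK ?num_real //.
    by have := sqr_ge0 (`|f t| - 1); nra.
  exists (2 * (1 + `|N|)); split=> [|t|s t].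
  - by rewrite mulr_ge0 ?addr_ge0.
  - by have := f1 t; have := ler_norm N; have := normr_ge0 N; lra.
  rewrite mulr1; apply: le_trans (ler_normB _ _) _.
  by have := f1 t; have := f1 s; have := ler_norm N; lra.
split; apply: bd => t; apply: le_trans (le_sq t); first by rewrite lerDl sqr_ge0.
by rewrite lerDr sqr_ge0.
Qed.

Lemma Lipmx_comp {S T : Type} (dS : S -> S -> R) (dT : T -> T -> R) (p : T -> S)
    (X : S -> M) : (forall s t, dS (p s) (p t) <= dT s t) ->
  Lipmx dS X -> Lipmx dT (fun t => X (p t)).
Proof.
move=> pd XL k l.
have tr f : bounded_Lipschitz dS f -> bounded_Lipschitz dT (fun t => f (p t)).
  move=> [K [K0 fK fL]]; exists K; split=> // s t.
  by apply: le_trans (fL _ _) _; rewrite ler_wpM2l.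
by have [X1 X2] := XL k l; split; [exact: (tr _ X1)|exact: (tr _ X2)].
Qed.

(** A bounded velocity makes a bounded solution Lipschitz. The absolute value makes the curve total,
    since solutions are controlled on the half line only. *)
Lemma Lipmx_msol (X V : R -> M) : msol X V -> Lipmx cst1 (fun t : R => X `|t|) ->
  Lipmx cst1 (fun t : R => V `|t|) -> Lipmx dabs (fun t : R => X `|t|).
Proof.
move=> dX Xb Vb k l.
have tr (f g : R -> R) : hder f g -> bounded_Lipschitz cst1 (fun t : R => f `|t|) ->
    bounded_Lipschitz cst1 (fun t : R => g `|t|) -> bounded_Lipschitz dabs (fun t : R => f `|t|).
  move=> df [K [K0 fK _]] [L [L0 gL _]]; exists (K + L); split=> [|t|s t].
  - exact: addr_ge0.
  - by apply: le_trans (fK t) _; rewrite lerDl.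
  have gL' t0 : 0 < t0 -> `|g t0| <= L by move=> t00; have := gL t0; rewrite (gtr0_norm t00).
  apply: le_trans (hder_Lipschitz df gL' (normr_ge0 s) (normr_ge0 t)) _.
  by apply: ler_pM => //; [rewrite lerDr|exact: ler_dist_dist].
have [X1 X2] := Xb k l; have [V1 V2] := Vb k l; split.
  exact: tr (msol_ReE k l dX) X1 V1.
exact: tr (msol_ImE k l dX) X2 V2.
Qed.

Let rP1 := @bounded_Lipschitz_ring_relation R R cst1 (fun _ _ => ler01).
Let rPd := @bounded_Lipschitz_ring_relation R R dabs (fun _ _ => normr_ge0 _).

Lemma twist_Lipmx : Lipmx dabs (fun t : R => Ht `|t|).
Proof.
have b1 : Lipmx cst1 (fun t : R => Ht `|t|).
  by apply: (@Lipmx_sqnorm _ _ (sqnorm H1)) => t; rewrite twist_sqnorm.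
have d1 : msol Ht (fun t => 0 + 'i%C *: bracket (diag_hamiltonian a) (Ht t)).
  have := msol_twist a (-1) (msol_cst H1).
  rewrite (_ : (fun t => _) = Ht); last by apply/funext => t; rewrite mulN1r.
  move/msol_ext; apply => t _; rewrite !mulN1r rmorphN rmorph1 mulN1r scaleNr opprK.
  by congr (_ + _); apply/matrixP => k l; rewrite twistE !mxE mulr0.
apply: (Lipmx_msol d1 b1); apply: (LipmxE (mrelD rP1 _ (mrelZ rP1 _ (mrel_bracket rP1 _ b1)))).
- exact: (mrel_cst rP1).
- exact: (crel_cst rP1).
- exact: (mrel_cst rP1).
Qed.

(** The solution is sought as [W X W^t*], where the unitary [W] is driven by the generator taken at
    that very matrix. *)
Theorem interaction_exists X : exists2 sigma : R -> M, sigma 0 = X &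
  interaction a H1 rhod0 sigma.
Proof.
have rP := bounded_Lipschitz_ring_relation (@dist_tx_ge0 R n).
pose A (t : R) (W : M) := generator `|t| (W *m X *m W^t*).
have AL : Lipmx (@dist_tx R n) (fun p => A p.1 (cutoff p.2)).
  have HL : Lipmx (@dist_tx R n) (fun p => Ht `|p.1|).
    apply: (@Lipmx_comp _ _ dabs _ fst) twist_Lipmx => s t.
    by rewrite /dist_tx lerDl sumr_ge0.
  have cL := @cutoff_Lipmx R n.
  apply: (LipmxE (mrelZ rP (crel_real rP (rel_feedback rP HL
    (mrelM rP (mrelM rP cL _) (mrel_adj rP cL)) _)) (mrelZ rP _ HL))).
  - exact: (mrel_cst rP).
  - exact: (mrel_cst rP).
  - exact: (crel_cst rP).
have [W [W0 WW dW]] := unitary_ode AL (fun t W => generator_antiherm _ _).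
exists (fun t => W t *m X *m (W t)^t*); first by rewrite W0 adjmx1 mulmx1 mul1mx.
have := msolM (msolM dW (msol_cst X)) (msol_adj dW).
move/msol_ext; apply => t t0.
rewrite mulmx0 addr0 adjmxM generator_antiherm /A gtr0_norm //.
by rewrite -bracketZl -/(generator t _) /bracket !mulmxN !mulmxA.
Qed.

Section Trajectory.
Variable sigma : R -> M.
Hypothesis dsigma : interaction a H1 rhod0 sigma.
Local Notation f := (fun t => feedback (Ht t) (sigma t) rhod0).

Lemma interaction_generator :
  msol sigma (fun t => bracket (generator t (sigma t)) (sigma t)).
Proof. by apply: msol_ext dsigma _ => t _; rewrite /generator [RHS]bracketZl. Qed.

(** The derivative of [tr (sigma^t* sigma)] is the trace of a commutator. This bound comes before
    [interaction_unitary], whose propagator is built from a bounded Lipschitz generator along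
    [sigma]. *)
Lemma interaction_sqnorm t : 0 <= t -> sqnorm (sigma t) = sqnorm (sigma 0).
Proof.
have dS := interaction_generator.
have := msol_trace (msolM (msol_adj dS) dS).
under eq_fun do rewrite -sqnorm_trace.
move/hder_eq0 => H t0; apply: H => // s s0.
rewrite adjmx_bracket generator_antiherm; set G := generator _ _; set S := sigma s.
rewrite (_ : _ + _ = bracket G (S^t* *m S)).
  by rewrite /bracket raddfB /= mxtrace_mulC subrr.
rewrite /bracket mulmxN mulNmx opprK mulmxDl mulmxBr mulNmx !mulmxA.
by rewrite addrACA addNr add0r.
Qed.

Lemma interaction_Lipmx : Lipmx dabs (fun t : R => sigma `|t|).
Proof.
have b1 : Lipmx cst1 (fun t : R => sigma `|t|).
  by apply: (@Lipmx_sqnorm _ _ (sqnorm (sigma 0))) => t; rewrite interaction_sqnorm.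
have h1 : Lipmx cst1 (fun t : R => Ht `|t|).
  by apply: (@Lipmx_sqnorm _ _ (sqnorm H1)) => t; rewrite twist_sqnorm.
apply: (Lipmx_msol dsigma b1).
apply: (LipmxE (mrelZ rP1 (crel_real rP1 (rel_feedback rP1 h1 b1 _))
  (mrel_bracket rP1 (mrelZ rP1 _ h1) b1))).
- exact: (mrel_cst rP1).
- exact: (crel_cst rP1).
Qed.

Lemma interaction_feedback_Lipschitz : exists2 K, 0 <= K &
  forall s t, 0 <= s -> 0 <= t -> `|f t - f s| <= K * `|t - s|.
Proof.
have [K [K0 _ fL]] : bounded_Lipschitz dabs (fun t : R => f `|t|).
  apply: (rel_feedback rPd twist_Lipmx interaction_Lipmx); exact: (mrel_cst rPd).
exists K => // s t s0 t0; by have := fL s t; rewrite (ger0_norm s0) (ger0_norm t0).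
Qed.

(** A given solution turns its own generator into a function of time. If [W] is the propagator of
    that linear equation, [W^t* sigma W] has zero derivative, so [sigma] moves by unitary
    conjugation. *)
Lemma interaction_unitary t : 0 <= t -> exists2 U : M, U *m U^t* = 1%:M &
  sigma t = U *m sigma 0 *m U^t*.
Proof.
pose A (s : R) (_ : M) := generator `|s| (sigma `|s|).
have AL : Lipmx (@dist_tx R n) (fun p => A p.1 (cutoff p.2)).
  apply: (@Lipmx_comp _ _ dabs _ fst (fun s : R => generator `|s| (sigma `|s|))).
    by move=> p q; rewrite /dist_tx lerDl sumr_ge0.
  apply: (LipmxE (mrelZ rPd (crel_real rPd (rel_feedback rPd twist_Lipmx interaction_Lipmx _))
    (mrelZ rPd _ twist_Lipmx))).
  - exact: (mrel_cst rPd).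
  - exact: (crel_cst rPd).
have [W [W0 WW dW]] := unitary_ode AL (fun t W => generator_antiherm _ _).
move=> t0; exists (W t); first by apply: mulmx1C; exact: WW.
have /msol_eq0 E := msolM (msolM (msol_adj dW) interaction_generator) dW.
have {E} := E _ t t0; rewrite W0 adjmx1 mulmx1 mul1mx => <-.
  by rewrite !mulmxA (mulmx1C (WW t t0)) mul1mx -mulmxA (mulmx1C (WW t t0)) mulmx1.
move=> s s0; rewrite /A gtr0_norm // adjmxM generator_antiherm.
set G := generator _ _; rewrite /bracket mulmxN mulNmx mulmxBr !mulmxA.
by rewrite addrA addNr sub0r mulNmx addNr.
Qed.

Lemma interaction_isospectral t : 0 <= t ->
  isospectral_manifold rhod0 (sigma 0) -> isospectral_manifold rhod0 (sigma t).
Proof.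
by move=> t0; have [U UU ->] := interaction_unitary t0; exact: isospectral_unitary.
Qed.

(** The derivative of [V] is [tr (sigma' (sigma - rhod0))]; the [sigma] part vanishes by cyclicity,
    and the rest is [- f] times the trace that defines [f]. *)
Lemma interaction_distV : hder (fun t => distV (sigma t) rhod0) (fun t => - f t ^+ 2).
Proof.
have dD := msolD dsigma (msol_cst (- rhod0)).
have [c1 d1] := msol_trace (msolM dD dD).
split=> [t t0|t t0].
  apply: cvgM; last exact: cvg_cst.
  exact: c1.
have := is_deriveZ (2^-1) (d1 t t0).
rewrite (_ : 2^-1 \*: _ = fun t => distV (sigma t) rhod0); last first.
  by apply/funext => s; rewrite /distV /GRing.scale /= mulrC.
move/is_derive_eq; apply.
rewrite addr0 raddfD /= [in X in _ + X]mxtrace_mulC raddfD /= -scalemxAl linearZ /=.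
set B := bracket _ (sigma t); set g := feedback _ _ _.
have -> : \tr (B *m (sigma t - rhod0)) = - \tr (B *m rhod0).
  rewrite mulmxBr raddfB /= /B /bracket mulmxBl raddfB /= mxtrace_mulC mulmxA subrr.
  by rewrite sub0r.
have -> : complex.Re (g%:C%C * - \tr (B *m rhod0)) = - (g * complex.Re (\tr (B *m rhod0))).
  by case: (\tr _) => u v /=; ring.
rewrite -/(feedback (Ht t) (sigma t) rhod0) -/g /GRing.scale /=.
by field.
Qed.

End Trajectory.
End InteractionPicture.

(** * Limit points of trajectories *)

Section Asymptotics.
Context {R : realType}.

Lemma hder_Lipschitz_from (f g : R -> R) (K T : R) : hder f g -> 0 <= T ->
  (forall t, T <= t -> `|g t| <= K) ->
  forall s t, T <= s -> T <= t -> `|f t - f s| <= K * `|t - s|.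
Proof.
move=> [cf df] T0 gK s t Ts Tt.
wlog st : s t Ts Tt / s < t.
  move=> H; have [st|st|->] := ltgtP s t; first exact: H.
    by rewrite distrC (distrC t); exact: H.
  by rewrite !subrr normr0 mulr0.
have sub : {within `[s, t], continuous f}.
  move/hcontE : cf; apply: continuous_subspaceW => x /=.
  by rewrite !in_itv /= andbT => /andP[/(le_trans (le_trans T0 Ts)) ->].
have [x|c] := @MVT R f g s t st _ sub.
  rewrite in_itv /= => /andP[sx _]; apply: df.
  by apply: le_lt_trans sx; exact: le_trans Ts.
rewrite in_itv /= => /andP[sc _] ->.
by rewrite normrM ler_wpM2r // gK // (le_trans Ts) // ltW.
Qed.

(* Barbalat's lemma. *)
Lemma dissipation_vanishes (V f : R -> R) (B K : R) :
  hder V (fun t => - f t ^+ 2) -> (forall t, 0 <= t -> B <= V t) -> 0 <= K ->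
  (forall s t, 0 <= s -> 0 <= t -> `|f t - f s| <= K * `|t - s|) ->
  f @ +oo --> (0 : R).
Proof.
move=> dV VB K0 fK; apply/cvgrPdist_lt => e e0.
have K1 : 0 < K + 1 by lra.
(* Over a time [h] the Lipschitz function [f] changes by at most [e / 2]. *)
pose h := e / (2 * (K + 1)).
have h0 : 0 < h by rewrite divr_gt0 // mulr_gt0.
(* If [|f|] reaches [e], then [V] loses at least [eta] in the next [h], which is impossible once [V]
   is within [eta] of its infimum. *)
pose eta := (e / 2) ^+ 2 * h.
have eta0 : 0 < eta by rewrite mulr_gt0 // exprn_gt0 // divr_gt0.
pose S := [set V t | t in [set t | 0 <= t]].
have hS : has_inf S.
  by split; [exists (V 0), 0 => /=|exists B => _ [t t0 <-]; exact: VB].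
have [_ [T /= T0 <-] VT] := inf_adherent eta0 hS.
have Vinf t : 0 <= t -> inf S <= V t.
  by move=> t0; apply: ge_inf; [exact: hS.2|exists t].
have mono s t : 0 <= s -> s <= t -> V t <= V s.
  move=> s0 st; rewrite -lerN2; apply: (hder_mono (hderN dV)) => // r _.
  by rewrite opprK sqr_ge0.
exists T; split=> [|t Tt]; first exact: num_real.
rewrite sub0r normrN ltNge; apply/negP => fe.
have t0 : 0 <= t by apply: le_trans T0 (ltW Tt).
have sub : {within `[t, t + h], continuous V}.
  have [/hcontE + _] := dV; apply: continuous_subspaceW => x /=.
  by rewrite !in_itv /= andbT => /andP[/(le_trans t0) ->].
have tth : t < t + h by rewrite ltrDl.
have [x|c] := @MVT R V (fun t => - f t ^+ 2) t (t + h) tth _ sub.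
  by rewrite in_itv /= => /andP[tx _]; apply: dV.2; exact: le_lt_trans tx.
rewrite in_itv /= => /andP[tc ch].
rewrite (_ : t + h - t = h); last by ring.
move=> E.
have A1 := fK t c t0 (ltW (le_lt_trans t0 tc)).
have A2 : K * `|c - t| <= e / 2.
  rewrite gtr0_norm ?subr_gt0 //.
  apply: (@le_trans _ _ ((K + 1) * h)).
    by apply: ler_pM => //; rewrite ?subr_ge0 ?(ltW tc) //; lra.
  by rewrite le_eqVlt /h; apply/orP; left; apply/eqP; field; rewrite gt_eqF.
have A3 : e / 2 <= `|f c|.
  have : `|f t| <= `|f c| + `|f c - f t|.
    by rewrite -[X in `|X| <= _](subrK (f c)) (le_trans (ler_normD _ _)) // addrC lerD2l distrC.
  lra.
have A4 : (e / 2) ^+ 2 <= f c ^+ 2.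
  by rewrite -[f c ^+ 2]real_normK ?num_real // lerXn2r // nnegrE ?divr_ge0 ?ltW.
have A5 : eta <= f c ^+ 2 * h by rewrite ler_wpM2r // ltW.
have A6 := mono T t T0 (ltW Tt).
have A7 := Vinf (t + h) (addr_ge0 t0 (ltW h0)).
rewrite mulNr in E; lra.
Qed.

Lemma pinfty_shift (s : R) : (fun t => t + s) @ +oo --> +oo.
Proof.
move=> A [M [_ MA]]; exists (M - s); split=> [|t]; first exact: num_real.
by rewrite ltrBlDr => /MA.
Qed.

Lemma near_pinfty_ge (T : R) : \forall t \near +oo, T <= t.
Proof. by exists T; split=> [|t /ltW]; first exact: num_real. Qed.

(** By compactness the image of the ultrafilter has a cluster point, and an ultrafilter converges to
    its cluster points. *)
Lemma ultra_bounded_cvg {T : Type} (F : set_system T) (f : T -> R) (K : R) :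
  UltraFilter F -> (forall t, `|f t| <= K) -> exists l : R, f @ F --> l.
Proof.
move=> FU fK.
have FK : (f @ F) [set` `[- K, K]].
  by apply: (@filterE _ F) => t; rewrite /= in_itv /= -ler_norml.
have [l [_ cl]] := @segment_compact R (- K) K (f @ F) _ FK.
exists l => A Al; have [//|FA] := in_ultra_setVsetC (f @^-1` A) FU.
have [x []] := cl (~` A) A FA Al; by [].
Qed.

(** Stands for the extraction of a convergent subsequence: one ultrafilter serves all entries at
    once. *)
Lemma ultra_bounded_mrel {T : Type} {n : nat} (F : set_system T) (X : T -> 'M[R[i]]_n)
    (N : R) : UltraFilter F -> (forall t, sqnorm (X t) <= N) ->
  exists A, mrel (fun f l => f @ F --> l) X A.
Proof.
move=> FU XN; have Xb := Lipmx_sqnorm XN.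
have /choice[A HA] k : exists A : 'I_n -> R[i], forall l,
    crel (fun f l => f @ F --> l) (fun t => X t k l) (A l).
  have [|A HA] := @choice _ _ (fun l z => crel (fun f l => f @ F --> l) (fun t => X t k l) z).
    move=> l; have [[K [_ K1 _]] [L [_ L1 _]]] := Xb k l.
    have [u Hu] := ultra_bounded_cvg FU K1; have [v Hv] := ultra_bounded_cvg FU L1.
    by exists (u +i* v)%C.
  by exists A.
by exists (\matrix_(k, l) A k l) => k l; rewrite mxE.
Qed.

Lemma crel_unique {T : Type} (F : set_system T) (x : T -> R[i]) (z w : R[i]) :
  ProperFilter F -> crel (fun f l => f @ F --> l) x z ->
  crel (fun f l => f @ F --> l) x w -> z = w.
Proof.
move=> FF [z1 z2] [w1 w2]; apply/eqP; rewrite eq_complex.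
by rewrite (cvg_unique _ z1 w1) // (cvg_unique _ z2 w2) // !eqxx.
Qed.

Lemma mrel_unique {T : Type} {n : nat} (F : set_system T) (X : T -> 'M[R[i]]_n) A B :
  ProperFilter F -> mrel (fun f l => f @ F --> l) X A ->
  mrel (fun f l => f @ F --> l) X B -> A = B.
Proof. by move=> FF XA XB; apply/matrixP => k l; exact: crel_unique (XA k l) (XB k l). Qed.

(** * Trigonometric sums that tend to 0 along a filter *)

Section TrigonometricSums.
Variables (F : set_system R) (J : finType) (w : J -> R).
Hypothesis FF : ProperFilter F.
Local Notation vanishing c :=
  (forall s, crel (fun f l => f @ F --> l) (fun t : R => \sum_j c j * cis (w j * (t + s))) 0).

Let rF := @cvg_ring_relation R R F _.

(* A suitable choice of [h] and [z] kills a given frequency. *)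
Lemma vanishing_filter (c : J -> R[i]) (h : R) (z : R[i]) : vanishing c ->
  vanishing (fun j => c j * (cis (w j * h) - z)).
Proof.
move=> Hc s.
have := crelD rF (Hc (s + h)) (crelM rF (crel_cst rF (- z)) (Hc s)).
rewrite mulr0 addr0; congr (crel _ _ _); apply/funext => t.
rewrite mulr_sumr -big_split; apply: eq_bigr => j _ /=.
by rewrite addrA mulrDr cisD; ring.
Qed.

(** Filters for all the other frequencies leave a single term [z * cis (v * t)]. Its modulus is
    constant and tends to 0, so [z = 0]; the factors contributed by the filters at [v] are
    nonzero. *)
Lemma vanishing_frequency (c : J -> R[i]) (v : R) : vanishing c ->
  \sum_(j | w j == v) c j = 0.
Proof.
move=> Hc.
pose L := [seq w j | j <- enum J & w j != v].
have Lv u : u \in L -> u != v by move=> /mapP[j]; rewrite mem_filter => /andP[? _] ->.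
(* With step [pi / (v - u)] the filter kills [u], while at [v] the two phases are opposite and add
   up instead of cancelling. *)
pose g (u x : R) := cis (x * (pi / (v - u))) - cis (u * (pi / (v - u))).
have gv u : u != v -> g u v != 0.
  move=> uv; rewrite /g (_ : v * _ = u * (pi / (v - u)) + pi); last first.
    by field; rewrite subr_eq0 eq_sym.
  rewrite cisD (_ : cis pi = -1); last first.
    by apply/eqP; rewrite eq_complex /= cospi sinpi /= oppr0 !eqxx.
  rewrite mulrN1 -opprD oppr_eq0 -mulr2n mulrn_eq0 /=; apply/eqP => E.
  have := congr1 (fun z => z * cis (- (u * (pi / (v - u))))) E.
  by rewrite /= -cisD subrr cis0 mul0r => /eqP; rewrite oner_eq0.
have HL : vanishing (fun j => c j * \prod_(u <- L) g u (w j)).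
  elim: (L) => [|u L' IH].
    by move=> s; have := Hc s; congr (crel _ _ _); apply/funext => t;
      apply: eq_bigr => j _; rewrite big_nil mulr1.
  move=> s; have := vanishing_filter (pi / (v - u)) (cis (u * (pi / (v - u)))) IH s.
  congr (crel _ _ _); apply/funext => t; apply: eq_bigr => j _.
  by rewrite big_cons /g; ring.
pose z := (\sum_(j | w j == v) c j) * \prod_(u <- L) g u v.
have Hz : crel (fun f l => f @ F --> l) (fun t : R => z * cis (v * t)) 0.
  have := HL 0; congr (crel _ _ _); apply/funext => t.
  rewrite (bigID (fun j => w j == v)) /= [X in _ + X]big1 ?addr0; last first.
    move=> j jv; rewrite (_ : \prod_(u <- L) _ = 0) ?mulr0 ?mul0r //.
    apply/eqP; rewrite prodf_seq_eq0; apply/hasP; exists (w j).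
      by apply/mapP; exists j => //; rewrite mem_filter jv mem_enum.
    by rewrite /= /g subrr.
  by rewrite /z !mulr_suml; apply: eq_bigr => j /eqP ->.
have := crelM rF Hz (crel_conj rF Hz).
rewrite mul0r (_ : (fun t => _) = fun=> z * z^*); last first.
  by apply/funext => t; rewrite rmorphM /= -cisN mulrACA -cisD subrr cis0 mulr1.
move/(crel_unique FF (crel_cst rF _))/eqP.
rewrite mulf_eq0 conjC_eq0 orbb /z mulf_eq0 => /orP[/eqP //|].
rewrite prodf_seq_eq0 => /hasP[u uL /=]; by rewrite (negbTE (gv u (Lv u uL))).
Qed.

(** Distinct indices may share a frequency, so the sum is cut into classes of equal frequency, each
    handled by [vanishing_frequency]. *)
Lemma vanishing_eq0 (c : J -> R[i]) : vanishing c ->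
  forall s, \sum_j c j * cis (w j * s) = 0.
Proof.
(* Canonical index of the class of [j]: it depends on [w j] alone, and the default never occurs
   because [j] itself qualifies. *)
move=> Hc s; pose r j := odflt j [pick i | w i == w j].
have wr j : w (r j) = w j.
  by rewrite /r; case: pickP => [i /eqP //|/(_ j)]; rewrite eqxx.
have rr i j : w i = w j -> r i = r j.
  move=> ij; rewrite /r ij; case: pickP => // /(_ j); by rewrite eqxx.
rewrite (partition_big r predT) //=; apply: big1 => i _.
have [/existsP[j /eqP rj]|/existsPn ni] := boolP [exists j, r j == i]; last first.
  by rewrite big1 // => j; rewrite (negbTE (ni j)).
rewrite (eq_bigl (fun k => w k == w j)) => [|k]; last first.
  rewrite -rj; apply/eqP/eqP => [rk|wk]; last exact: rr.
  by rewrite -(wr k) -(wr j) rk.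
rewrite (eq_bigr (fun k => c k * cis (w j * s))) => [|k /eqP -> //].
by rewrite -mulr_suml vanishing_frequency // mul0r.
Qed.

End TrigonometricSums.
End Asymptotics.

(** * Limit points as elements of the LaSalle set *)

Section LimitPoints.
Context {R : realType} {n : nat}.
Local Notation M := 'M[R[i]]_n.
Variables (a : 'rV[R]_n) (H1 rhod0 : M).
Hypotheses (H1_herm : H1 \is hermsymmx) (rhod0_density : density_operator rhod0).
Local Notation Ht := (fun t => twist a H1 (- t)).
Local Notation cst1 := (fun _ _ => (1 : R)).

(** Late velocities are at most [C] times a small feedback, so increments over the fixed time [s]
    are small by the mean value theorem. *)
Lemma increment_vanishes (f g v : R -> R) (C s : R) : hder g v -> 0 <= C ->
  (forall t, 0 <= t -> `|v t| <= C * `|f t|) -> f @ +oo --> (0 : R) ->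
  (fun t => g (t + s) - g t) @ +oo --> (0 : R).
Proof.
move=> dg C0 vC f0; apply/cvgrPdist_lt => e e0.
have D0 : 0 < C * `|s| + 1 by rewrite ltr_wpDl // mulr_ge0.
have /cvgrPdist_lt/(_ _ (divr_gt0 e0 D0)) [T [_ HT]] := f0.
pose T' := `|T| + 1; have T'0 : 0 <= T' by rewrite addr_ge0.
have vT t : T' <= t -> `|v t| <= C * (e / (C * `|s| + 1)).
  move=> Tt; apply: le_trans (vC _ (le_trans T'0 Tt)) _; rewrite ler_wpM2l //.
  have := HT t; rewrite sub0r normrN => /(_ _)/ltW; apply.
  by have := ler_norm T; rewrite /T' in Tt; lra.
exists (T' + `|s|); split=> [|t Tt]; first exact: num_real.
have A1 : T' <= t by have := normr_ge0 s; lra.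
have A2 : T' <= t + s by have := ler_norm (- s); rewrite normrN; lra.
rewrite sub0r normrN; apply: le_lt_trans (hder_Lipschitz_from dg T'0 vT A1 A2) _.
rewrite (_ : t + s - t = s); last by ring.
rewrite mulrAC mulrA ltr_pdivrMr // mulrC ltr_pM2l //.
by rewrite mulrC ltrDl.
Qed.

Lemma hermsymm_isospectral A : isospectral_manifold rhod0 A -> A \is hermsymmx.
Proof. by case=> -[]. Qed.

Lemma sqnorm_unitary (U : M) : U *m U^t* = 1%:M -> sqnorm U = n%:R.
Proof.
by move=> /mulmx1C UU; rewrite sqnorm_trace UU mxtrace1 raddfMn.
Qed.

(* The trace of [-i H(t) [A, rhod0]] is a trigonometric sum in [t]. *)
Lemma feedback_trigonometric (A : M) t : A \is hermsymmx ->
  (feedback (Ht t) A rhod0)%:C%C =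
  \sum_(p : 'I_n * 'I_n) (- 'i%C * (H1 p.1 p.2 * bracket A rhod0 p.2 p.1)) *
    cis ((a 0 p.1 - a 0 p.2) * t).
Proof.
move=> Ah; have Hh : Ht t \is hermsymmx by exact/hermsymmxP/twist_herm.
have [rh _ _] := rhod0_density; rewrite (feedbackE Hh Ah rh).
have -> : \tr (bracket (- 'i%C *: Ht t) A *m rhod0) = - 'i%C * \tr (Ht t *m bracket A rhod0).
  rewrite bracketZl -scalemxAl linearZ /=; congr (_ * _).
  rewrite /bracket mulmxBl mulmxBr !raddfB /= !mulmxA; congr (_ - _).
  by rewrite -(mulmxA A) mxtrace_mulC.
rewrite mulr_sumr -(pair_bigA _ (fun k l => (- 'i%C * (H1 k l * bracket A rhod0 l k)) *
    cis ((a 0 k - a 0 l) * t))) /=.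
apply: eq_bigr => k _; rewrite mxE mulr_sumr; apply: eq_bigr => l _.
rewrite twistE (_ : (a 0 l - a 0 k) * - t = (a 0 k - a 0 l) * t); last by ring.
by ring.
Qed.

(** With zero feedback both matrices evolve freely, and their distance is constant because the twist
    preserves [distV]. *)
Lemma LaSalle_set_intro (A : M) : isospectral_manifold rhod0 A ->
  (forall t, feedback (Ht t) A rhod0 = 0) ->
  LaSalle_set (diag_hamiltonian a) H1 rhod0 (A, rhod0).
Proof.
move=> Aiso fb0.
have vel (X v : R -> M) : (forall t, mder t X (v t)) -> has_velocity setT X v.
  move=> dX k l; split; last by move=> t _; exact: dX.
    by apply: continuous_subspaceT => t; apply: differentiable_continuous;
      apply/derivable1_diffP; have [D _] := dX t k l; exact: ex_derive.
  by apply: continuous_subspaceT => t; apply: differentiable_continuous;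
    apply/derivable1_diffP; have [_ D] := dX t k l; exact: ex_derive.
have dtw (X : M) t : mder t (twist a X) (- 'i%C *: bracket (diag_hamiltonian a) (twist a X t)).
  have := mder_twist a 1 (mder_cst t X); rewrite mul1r.
  rewrite (_ : (fun s => _) = twist a X); last by apply/funext => s; rewrite mul1r.
  rewrite rmorph1 mul1r (_ : twist a 0 t = 0) ?sub0r -?scaleNr //.
  by apply/matrixP => k l; rewrite twistE mxE mulr0.
split=> //; first by exists 0; rewrite free_evolutionE twist0.
exists (twist a A), (twist a rhod0); split.
- by rewrite !twist0.
- apply: vel => t; rewrite (_ : feedback _ _ _ = 0) ?scale0r ?addr0 //; last first.
    rewrite -(fb0 t) -(twist_feedback a H1 _ _ (- t)) !twistK //.
- exact: vel.
- by move=> t; under eq_fun do rewrite twist_distV; exact: is_derive_cst.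
Qed.

Section Trajectory.
Variable sigma : R -> M.
Hypotheses (dsigma : interaction a H1 rhod0 sigma)
  (sigma0 : isospectral_manifold rhod0 (sigma 0)).

Lemma interaction_feedback_cvg :
  (fun t => feedback (Ht t) (sigma t) rhod0) @ +oo --> (0 : R).
Proof.
have [K K0 fK] := interaction_feedback_Lipschitz H1_herm dsigma.
have rP := @bounded_Lipschitz_ring_relation R R (fun s t : R => `|t - s|) (fun _ _ => normr_ge0 _).
have [B [B0 VB _]] : bounded_Lipschitz (fun s t : R => `|t - s|)
    (fun t : R => distV (sigma `|t|) rhod0).
  apply: (rel_distV rP (interaction_Lipmx H1_herm dsigma)); exact: (mrel_cst rP).
apply: (dissipation_vanishes (interaction_distV dsigma) (B := - B) _ K0 fK).
by move=> t t0; have := VB t; rewrite (ger0_norm t0) ler_norml => /andP[].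
Qed.

Lemma interaction_increment_vanishes s :
  mrel (fun (f : R -> R) l => f @ +oo --> l) (fun t => sigma (t + s) - sigma t) 0.
Proof.
have rP := @bounded_Lipschitz_ring_relation R R cst1 (fun _ _ => ler01).
have b1 : Lipmx cst1 (fun t : R => sigma `|t|).
  by apply: (@Lipmx_sqnorm _ _ _ _ (sqnorm (sigma 0))) => t;
    rewrite (interaction_sqnorm H1_herm dsigma).
have h1 : Lipmx cst1 (fun t : R => Ht `|t|).
  by apply: (@Lipmx_sqnorm _ _ _ _ (sqnorm H1)) => t; rewrite twist_sqnorm.
have Bb : Lipmx cst1 (fun t : R => bracket (- 'i%C *: Ht `|t|) (sigma `|t|)).
  apply: (LipmxE (mrel_bracket rP (mrelZ rP _ h1) b1)); exact: (crel_cst rP).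
have f0 := interaction_feedback_cvg.
have E z (B : M) k l : (z *: B) k l = z * B k l by rewrite mxE.
move=> k l; rewrite mxE; have [[C [C0 BC _]] [D [D0 BD _]]] := Bb k l.
split; under eq_fun do rewrite !mxE raddfB /=.
  apply: (increment_vanishes s (msol_ReE k l dsigma) C0 _ f0) => t t0.
  have := BC t; rewrite (ger0_norm t0) E; case: (bracket (- 'i%C *: Ht t) (sigma t) k l) => u v /= uC.
  by rewrite mul0r subr0 normrM mulrC ler_wpM2r.
apply: (increment_vanishes s (msol_ImE k l dsigma) D0 _ f0) => t t0.
have := BD t; rewrite (ger0_norm t0) E; case: (bracket (- 'i%C *: Ht t) (sigma t) k l) => u v /= uC.
by rewrite mul0r addr0 normrM mulrC ler_wpM2r.
Qed.

Variable F : set_system R.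
Hypotheses (FU : UltraFilter F) (Foo : F --> +oo).

Let rF := @cvg_ring_relation R R F _.

Lemma mrel_pinfty (X : R -> M) (A : M) :
  mrel (fun (f : R -> R) l => f @ +oo --> l) X A -> mrel (fun f l => f @ F --> l) X A.
Proof.
by move=> XA k l; have [X1 X2] := XA k l; split; apply: cvg_trans _ X1 + apply: cvg_trans _ X2;
  move=> U /Foo.
Qed.

(** The conjugating unitaries form a bounded family, hence converge along the ultrafilter, and their
    limit is unitary; so the limit point is conjugate to [sigma 0]. *)
Lemma limit_isospectral (A : M) : mrel (fun f l => f @ F --> l) sigma A ->
  isospectral_manifold rhod0 A.
Proof.
move=> sA.
have /choice[U HU] (t : R) : exists U : M, U *m U^t* = 1%:M /\
    sigma `|t| = U *m sigma 0 *m U^t*.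
  by have [U] := interaction_unitary H1_herm dsigma (normr_ge0 t); exists U.
have [|W UW] := @ultra_bounded_mrel R R n F U n%:R FU.
  by move=> t; rewrite sqnorm_unitary //; exact: (HU t).1.
have WW : W *m W^t* = 1%:M.
  apply: (mrel_unique _ (mrelM rF UW (mrel_adj rF UW))).
  rewrite (_ : (fun t => _) = fun=> 1%:M); first exact: (mrel_cst rF).
  by apply/funext => t; exact: (HU t).1.
rewrite (_ : A = W *m sigma 0 *m W^t*); first exact: isospectral_unitary.
apply: (mrel_unique _ sA).
have UX := mrelM rF (mrelM rF UW (mrel_cst rF (sigma 0))) (mrel_adj rF UW).
have ev : \forall t \near F, sigma t = U t *m sigma 0 *m (U t)^t*.
  by apply: filterS (Foo (near_pinfty_ge 0)) => t t0; rewrite -(HU t).2 ger0_norm.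
move=> k l; have [U1 U2] := UX k l; split.
  by apply: cvg_trans U1; apply: near_eq_cvg; apply: filterS ev => t /= ->.
by apply: cvg_trans U2; apply: near_eq_cvg; apply: filterS ev => t /= ->.
Qed.

Lemma limit_critical (A : M) : LaSalle_regular (diag_hamiltonian a) H1 rhod0 ->
  mrel (fun f l => f @ F --> l) sigma A -> critical_points rhod0 A.
Proof.
move=> reg sA; have Aiso := limit_isospectral sA; split=> //.
have Ah := hermsymm_isospectral Aiso.
have fbA s : (fun t => feedback (Ht (t + s)) A rhod0) @ F --> (0 : R).
  (* The moving [H1] also converges along the ultrafilter, to some [G]; hence the feedbacks at [A]
     and at [sigma (t + s)] have the same limit, which is 0. *)
  have [|G HG] := @ultra_bounded_mrel R R n F (fun t => Ht (t + s)) (sqnorm H1) FU.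
    by move=> t; rewrite twist_sqnorm.
  (* A time shift need not preserve the ultrafilter; the vanishing increments give the limit of the
     shifted curve. *)
  have sAs : mrel (fun f l => f @ F --> l) (fun t => sigma (t + s)) A.
    have := mrelD rF (mrel_pinfty (interaction_increment_vanishes s)) sA; rewrite add0r.
    by congr (mrel _ _ _); apply/funext => t; rewrite subrK.
  have L1 := rel_feedback rF HG sAs (mrel_cst rF rhod0).
  have L2 : (fun t => feedback (Ht (t + s)) (sigma (t + s)) rhod0) @ F --> (0 : R).
    have : (fun t => feedback (Ht (t + s)) (sigma (t + s)) rhod0) @ +oo --> (0 : R).
      exact: cvg_comp (@pinfty_shift R s) interaction_feedback_cvg.
    by apply: cvg_trans => U /Foo.
  have E : feedback G A rhod0 = 0 by apply: (cvg_unique _ L1 L2).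
  by have := rel_feedback rF HG (mrel_cst rF A) (mrel_cst rF rhod0); rewrite E.
have fb0 t : feedback (Ht t) A rhod0 = 0.
  have := @vanishing_eq0 R F _ (fun p : 'I_n * 'I_n => a 0 p.1 - a 0 p.2) _
    (fun p => - 'i%C * (H1 p.1 p.2 * bracket A rhod0 p.2 p.1)).
  move=> /(_ _ _ t); rewrite -feedback_trigonometric //.
  move=> H; have : (feedback (Ht t) A rhod0)%:C%C = 0.
    apply: H => s; have := crel_real rF (fbA s).
    by congr (crel _ _ _); apply/funext => u; rewrite feedback_trigonometric.
  by move/(congr1 (@complex.Re R)).
exact: reg (LaSalle_set_intro Aiso fb0).
Qed.

End Trajectory.
End LimitPoints.

(** * Critical points and extrema of the distance *)

Section CriticalPoints.
Context {R : realType} {n : nat}.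
Local Notation M := 'M[R[i]]_n.
Implicit Types (X Y U P : M) (v : 'I_n -> R) (s : {perm 'I_n}).

Definition real_diag v : M := locked (diag_mx (\row_i (v i)%:C%C)).

Lemma real_diag_def v : real_diag v = diag_mx (\row_i (v i)%:C%C).
Proof. by rewrite /real_diag -lock. Qed.

Lemma real_diagE v i j : real_diag v i j = (v i)%:C%C *+ (i == j).
Proof. by rewrite real_diag_def !mxE. Qed.

Lemma char_poly_real_diag v : char_poly (real_diag v) = \prod_i ('X - ((v i)%:C%C)%:P).
Proof.
rewrite char_poly_trig; last by rewrite real_diag_def diag_mx_is_trig.
apply: eq_bigr => i _.
by rewrite real_diagE eqxx.
Qed.

Lemma root_char_poly_real_diag v z :
  root (char_poly (real_diag v)) z = (z \in [seq (v i)%:C%C | i : 'I_n]).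
Proof.
rewrite char_poly_real_diag (_ : \prod_i _ = \prod_(x <- [seq (v i)%:C%C | i : 'I_n]) ('X - x%:P)).
  exact: root_prod_XsubC.
by rewrite big_image.
Qed.

Lemma hermitian_diagonalization X : X \is hermsymmx ->
  exists P, exists2 v, P *m P^t* = 1%:M & X = P^t* *m real_diag v *m P.
Proof.
move=> Xh; have /unitarymxP := spectral_unitarymx X.
have := orthomx_spectralP (hermitian_normalmx Xh).
have /mxOverP := hermitian_spectral_diag_real Xh.
rewrite invmx_unitary ?spectral_unitarymx //.
move: (spectralmx X) (spectral_diag X) => Q d D E QQ.
exists Q, (fun i => complex.Re (d 0 i)); first exact: QQ.
rewrite [LHS]E real_diag_def; rewrite (_ : \row_i _ = d) //.
apply/rowP => i; rewrite mxE; have := D 0 i.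
by case: (d 0 i) => x y; rewrite complex_real => /= /eqP ->.
Qed.

Lemma unitary_conjK P X : P *m P^t* = 1%:M -> P *m (P^t* *m X *m P) *m P^t* = X.
Proof. by move=> PP; rewrite !mulmxA PP mul1mx -mulmxA PP mulmx1. Qed.

Lemma unitary_conjVK P X : P *m P^t* = 1%:M -> P^t* *m (P *m X *m P^t*) *m P = X.
Proof.
by move=> /mulmx1C PP; rewrite !mulmxA PP mul1mx -mulmxA PP mulmx1.
Qed.

Lemma unitary_conj_inj P X Y : P *m P^t* = 1%:M ->
  P^t* *m X *m P = P^t* *m Y *m P -> X = Y.
Proof. by move=> PP E; rewrite -(unitary_conjK X PP) E unitary_conjK. Qed.

Lemma unitary_conj_mul P X Y : P *m P^t* = 1%:M ->
  P^t* *m X *m P *m (P^t* *m Y *m P) = P^t* *m (X *m Y) *m P.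
Proof. by move=> PP; rewrite !mulmxA -(mulmxA _ P (P^t*)) PP mulmx1. Qed.

Lemma unitary_conj_change (P Q U X : M) : P *m P^t* = 1%:M ->
  Q^t* *m (U *m X *m U^t*) *m Q =
  Q^t* *m U *m P *m (P^t* *m X *m P) *m (Q^t* *m U *m P)^t*.
Proof.
move=> PP; rewrite !adjmxM adjmxK !mulmxA.
by rewrite -(mulmxA _ P (P^t*)) PP mulmx1 -(mulmxA _ P (P^t*)) PP mulmx1.
Qed.

Lemma real_diag_perm v s :
  real_diag (v \o s) = perm_mx s *m real_diag v *m (perm_mx s)^t*.
Proof.
rewrite !real_diag_def tr_perm_mx map_perm_mx -row_permE -col_permE.
by apply/matrixP => i j; rewrite !mxE (inj_eq perm_inj).
Qed.

Lemma perm_mx_unitary s : (perm_mx s : M) *m (perm_mx s)^t* = 1%:M.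
Proof. by rewrite tr_perm_mx map_perm_mx -perm_mxM mulgV perm_mx1. Qed.

Lemma unitaryM (U V : M) : U *m U^t* = 1%:M -> V *m V^t* = 1%:M ->
  (U *m V) *m (U *m V)^t* = 1%:M.
Proof. by move=> UU VV; rewrite adjmxM !mulmxA -(mulmxA U) VV mulmx1. Qed.

Lemma unitary_adj U : U *m U^t* = 1%:M -> U^t* *m U^t*^t* = 1%:M.
Proof. by rewrite adjmxK; exact: mulmx1C. Qed.

(** Each [v i] is a root, so [v i = v' (g i)] for some [g]; injectivity of [v] makes [g] a
    permutation, and its inverse is the one sought. *)
Lemma char_poly_real_diag_perm v v' : injective v ->
  char_poly (real_diag v') = char_poly (real_diag v) -> exists s, v' =1 v \o s.
Proof.
move=> vi E.
have /fin_all_exists[g gv] i : exists j, v' j = v i.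
  have : root (char_poly (real_diag v')) (v i)%:C%C.
    by rewrite E root_char_poly_real_diag; apply/mapP; exists i; rewrite ?mem_enum.
  by rewrite root_char_poly_real_diag => /mapP[j _ /(congr1 (@complex.Re R)) /= ->]; exists j.
have gi : injective g by move=> i j gij; apply: vi; rewrite -!gv gij.
exists (perm gi)^-1%g => j /=.
by rewrite -gv -[in LHS](permKV (perm gi) j) permE.
Qed.

(** The [n] distinct eigenvalues all occur among the [n] diagonal entries, which therefore do not
    repeat. *)
Lemma generic_diagonalization rhod0 : density_operator rhod0 -> generic rhod0 ->
  exists P, exists v, [/\ P *m P^t* = 1%:M, injective v &
    rhod0 = P^t* *m real_diag v *m P].
Proof.
move=> [rh _ _] [l [lu ls lE]]; have [P [v PP rE]] := hermitian_diagonalization rh.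
exists P, v; split=> //.
have /(leq_size_uniq lu) : {subset l <= [seq (v i)%:C%C | i : 'I_n]}.
  move=> z /lE; rewrite eigenvalue_root_char rE.
  have := char_poly_unitary (real_diag v) (unitary_adj PP); rewrite adjmxK => ->.
  by rewrite root_char_poly_real_diag.
rewrite size_map ls size_enum_ord leqnn => /(_ isT) /injectiveP vi i j vij.
by apply: vi; rewrite vij.
Qed.

Section Spectrum.
Variables (rhod0 P : M) (v : 'I_n -> R).
Hypotheses (PP : P *m P^t* = 1%:M) (v_inj : injective v)
  (rhod0E : rhod0 = P^t* *m real_diag v *m P) (rhod0_density : density_operator rhod0).

Definition critical_point s : M := P^t* *m real_diag (v \o s) *m P.

Let PP' : P^t* *m P = 1%:M. Proof. exact: mulmx1C. Qed.

Lemma char_poly_rhod0 : char_poly rhod0 = char_poly (real_diag v).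
Proof. by rewrite rhod0E -{2}[P]adjmxK char_poly_unitary ?unitary_adj. Qed.

(** Unitary conjugation acts transitively: the diagonal forms of two matrices of the manifold differ
    by a permutation of the basis. *)
Lemma isospectralP X : isospectral_manifold rhod0 X <->
  exists2 U, U *m U^t* = 1%:M & X = U *m rhod0 *m U^t*.
Proof.
split=> [[[Xh _ _] Xc]|[U UU ->]]; last exact: isospectral_unitary.
have [Q [w QQ XE]] := hermitian_diagonalization Xh.
have [|s ws] := @char_poly_real_diag_perm v w v_inj.
  rewrite -char_poly_rhod0 -Xc XE -{2}[Q]adjmxK char_poly_unitary //.
  exact: unitary_adj.
exists (Q^t* *m perm_mx s *m P).
  by apply: unitaryM => //; apply: unitaryM; [exact: unitary_adj|exact: perm_mx_unitary].
have W : w = v \o s by apply/funext.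
by rewrite XE rhod0E W real_diag_perm; exact: unitary_conj_change.
Qed.

Lemma critical_point_critical s : critical_points rhod0 (critical_point s).
Proof.
split.
  apply/isospectralP; exists (P^t* *m perm_mx s *m P).
    by apply: unitaryM => //; apply: unitaryM; [exact: unitary_adj|exact: perm_mx_unitary].
  by rewrite /critical_point real_diag_perm rhod0E; exact: unitary_conj_change.
have : real_diag (v \o s) *m real_diag v = real_diag v *m real_diag (v \o s).
  by rewrite !real_diag_def; exact: diag_mx_comm.
rewrite /bracket rhod0E /critical_point.
move: (real_diag _) (real_diag v) => A B AB.
by rewrite (unitary_conj_mul A B PP) (unitary_conj_mul B A PP) AB subrr.
Qed.

Lemma critical_point_inj : injective critical_point.
Proof.
move=> s t /(unitary_conj_inj PP) /matrixP E; apply/permP => i; apply: v_inj.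
by have := E i i; rewrite !real_diagE eqxx !mulr1n => /(congr1 (@complex.Re R)).
Qed.

(** In the eigenbasis of [rhod0], commuting with a diagonal matrix of distinct entries means being
    diagonal, and the spectrum fixes the entries up to order. *)
Lemma critical_pointP X : critical_points rhod0 X -> exists s, X = critical_point s.
Proof.
move=> [[[Xh Xp Xt] Xc] XC].
have [Y [XE YD Yh Yc]] : exists Y : M, [/\ X = P^t* *m Y *m P,
    Y *m real_diag v = real_diag v *m Y, Y^t* = Y & char_poly Y = char_poly X].
  exists (P *m X *m P^t*); split.
  - by rewrite unitary_conjVK.
  - have DE : real_diag v = P *m rhod0 *m P^t* by rewrite rhod0E unitary_conjK.
    have XR : X *m rhod0 = rhod0 *m X := subr0_eq XC.
    rewrite DE; transitivity (P *m (X *m rhod0) *m P^t*).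
      by rewrite !mulmxA -(mulmxA _ (P^t*) P) PP' mulmx1.
    by rewrite XR !mulmxA -(mulmxA _ (P^t*) P) PP' mulmx1.
  - by rewrite !adjmxM adjmxK (hermsymmxE Xh) mulmxA.
  - exact: char_poly_unitary.
have Yd i j : i != j -> Y i j = 0.
  move=> ij; have /matrixP/(_ i j) := YD.
  rewrite real_diag_def mul_diag_mx mul_mx_diag !mxE mulrC => /eqP.
  rewrite -subr_eq0 -mulrBl mulf_eq0 subr_eq0 => /orP[|/eqP //].
  move=> /eqP /(congr1 (@complex.Re R)) /= /v_inj E; by rewrite E eqxx in ij.
have YE : Y = real_diag (fun i => complex.Re (Y i i)).
  apply/matrixP => i j; rewrite real_diagE; case: eqVneq => [<-|/Yd //].
  have /matrixP/(_ i i) := Yh; rewrite !mxE mulr1n.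
  case: (Y i i) => x y /(congr1 (@complex.Im R)) /= E.
  by congr (_ +i* _)%C; lra.
have [|s ws] := @char_poly_real_diag_perm v (fun i => complex.Re (Y i i)) v_inj.
  by rewrite -YE -char_poly_rhod0 -Xc.
have W : (fun i => complex.Re (Y i i)) = v \o s by apply/funext.
by exists s; rewrite XE [in LHS]YE /critical_point W.
Qed.

(** On the isospectral manifold the distance to [rhod0] is a constant minus this linear function,
    see [distV_overlap]; maxima of the distance are minima of the overlap. *)
Definition overlap X : R := complex.Re (\tr (X *m rhod0)).

Lemma overlapE X : overlap X = \sum_i v i * complex.Re ((P *m X *m P^t*) i i).
Proof.
rewrite /overlap rhod0E !mulmxA mxtrace_mulC !mulmxA raddf_sum; apply: eq_bigr => i _.
rewrite real_diag_def mul_mx_diag !mxE.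
by case: (\sum_j _) => x y /=; rewrite mulr0 subr0 mulrC.
Qed.

Lemma distV_overlap X : isospectral_manifold rhod0 X ->
  distV X rhod0 = complex.Re (\tr (rhod0 *m rhod0)) - overlap X.
Proof.
move=> /isospectralP[U UU XE].
have XX : \tr (X *m X) = \tr (rhod0 *m rhod0).
  rewrite {1 2}XE !mulmxA -(mulmxA _ (U^t*)) (mulmx1C UU) mulmx1 mxtrace_mulC !mulmxA.
  by rewrite (mulmx1C UU) mul1mx.
rewrite /distV -[(X - rhod0) ^+ 2]/((X - rhod0) *m (X - rhod0)).
rewrite mulmxBl !mulmxBr !raddfB /= XX (mxtrace_mulC rhod0 X) -/(overlap X).
by field.
Qed.

Lemma distV_sqnorm X Y : X \is hermsymmx -> Y \is hermsymmx ->
  distV X Y = sqnorm (X - Y) / 2.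
Proof.
move=> Xh Yh; rewrite sqnorm_trace adjmxD adjmxN !hermsymmxE //.
Qed.

(** Complex Givens rotation in the plane of [p] and [q], with cosine [c] and complex sine [z]. *)
Definition rotation (p q : 'I_n) (c : R) (z : R[i]) : M := \matrix_(i, j)
  if i == p then c%:C%C *+ (j == p) - z^* *+ (j == q)
  else if i == q then z *+ (j == p) + c%:C%C *+ (j == q) else (i == j)%:R.

Lemma rotationE p q c z i j : rotation p q c z i j =
  if i == p then c%:C%C *+ (j == p) - z^* *+ (j == q)
  else if i == q then z *+ (j == p) + c%:C%C *+ (j == q) else (i == j)%:R.
Proof. by rewrite mxE. Qed.

Section Rotation.
Variables (p q : 'I_n) (c : R) (z : R[i]).
Hypotheses (pq : p != q) (cz : c%:C%C ^+ 2 + z * z^* = 1).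

Lemma sum_rotation (f : 'I_n -> R[i]) i : \sum_k rotation p q c z i k * f k =
  if i == p then c%:C%C * f p - z^* * f q
  else if i == q then z * f p + c%:C%C * f q else f i.
Proof.
have single (j : 'I_n) (x : R[i]) : \sum_k x *+ (k == j) * f k = x * f j.
  rewrite (bigD1 j) //= eqxx big1 ?addr0 // => k kj.
  by rewrite (negbTE kj) mulr0n mul0r.
under eq_bigr do rewrite mxE.
case: ifP => _.
  by under eq_bigr do rewrite mulrBl; rewrite sumrB !single.
case: ifP => _; first by under eq_bigr do rewrite mulrDl; rewrite big_split /= !single.
rewrite -[RHS]mul1r -(single i 1); apply: eq_bigr => k _; by rewrite eq_sym.
Qed.

Lemma sum_rotation_conj (f : 'I_n -> R[i]) i : \sum_k f k * (rotation p q c z i k)^* =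
  if i == p then c%:C%C * f p - z * f q
  else if i == q then z^* * f p + c%:C%C * f q else f i.
Proof.
have cc : (c%:C%C : R[i])^* = c%:C%C by rewrite -[LHS]/(conjc _) conjc_real.
rewrite -[LHS]conjCK rmorph_sum /=.
rewrite (eq_bigr (fun k => rotation p q c z i k * (f k)^*)); last first.
  by move=> k _; rewrite rmorphM /= conjCK mulrC.
rewrite sum_rotation; case: (i == p); last case: (i == q);
  by rewrite ?rmorphB ?rmorphD ?rmorphM /= ?conjCK ?cc.
Qed.

Lemma rotation_unitary : rotation p q c z *m (rotation p q c z)^t* = 1%:M.
Proof.
have cc : (c%:C%C : R[i])^* = c%:C%C by rewrite -[LHS]/(conjc _) conjc_real.
have qp : (q == p) = false by rewrite eq_sym (negbTE pq).
apply/matrixP => i j; rewrite mxE.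
under eq_bigr do rewrite [in X in _ * X]mxE [in X in _ * X]mxE.
rewrite sum_rotation_conj !mxE !eqxx (negbTE pq) qp.
have [Ei|ip] := eqVneq i p; have [Ej|jp] := eqVneq j p.
- by rewrite Ei Ej eqxx -cz /=; ring.
- have [Ej|jq] := eqVneq j q.
    by rewrite Ei Ej ?eqxx (negbTE pq) /=; ring.
  by rewrite Ei (eq_sym p) (negbTE jp) /= subrr.
- have [Ei|iq] := eqVneq i q.
    by rewrite Ei Ej ?eqxx ?qp /=; ring.
  by rewrite Ej (negbTE ip) /=; ring.
have [Ej|jq] := eqVneq j q; have [Ei|iq] := eqVneq i q => //.
- by rewrite Ei Ej eqxx -cz /=; ring.
- by rewrite Ej (negbTE iq) /=; ring.
by rewrite Ei (eq_sym q) (negbTE jq) /= addr0.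
Qed.

(* In the eigenbasis of [rhod0] the rotation moves only two diagonal entries of [X],
   by opposite amounts. *)
Lemma overlap_rotation X : X \is hermsymmx ->
  let Y := P *m X *m P^t* in let G := rotation p q c z in
  overlap ((P^t* *m G *m P) *m X *m (P^t* *m G *m P)^t*) = overlap X +
  (v p - v q) * (complex.Re (z * z^*) * (complex.Re (Y q q) - complex.Re (Y p p))
    - 2 * c * complex.Re (z * Y p q)).
Proof.
move=> Xh Y G.
have qp : (q == p) = false by rewrite eq_sym (negbTE pq).
have -> : overlap ((P^t* *m G *m P) *m X *m (P^t* *m G *m P)^t*) =
    \sum_i v i * complex.Re ((G *m Y *m G^t*) i i).
  rewrite overlapE; apply: eq_bigr => i _; congr (_ * complex.Re _).
  rewrite !adjmxM adjmxK /Y !mulmxA PP mul1mx.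
  by rewrite -(mulmxA _ P (P^t*)) PP mulmx1.
rewrite overlapE -/Y.
have Yh : Y^t* = Y by rewrite /Y !adjmxM adjmxK (hermsymmxE Xh) mulmxA.
have GYG i : (G *m Y *m G^t*) i i =
  if i == p then c%:C%C * (c%:C%C * Y p p - z^* * Y q p) - z * (c%:C%C * Y p q - z^* * Y q q)
  else if i == q then z^* * (z * Y p p + c%:C%C * Y q p) + c%:C%C * (z * Y p q + c%:C%C * Y q q)
  else Y i i.
  rewrite mxE; under eq_bigr do
    rewrite [in X in _ * X]mxE [in X in _ * X]mxE [in X in X * _]mxE sum_rotation.
  rewrite sum_rotation_conj; have [//|ip] := eqVneq i p.
  by have [] := eqVneq i q.
have Yqp : Y q p = (Y p q)^* by have /matrixP/(_ q p) := Yh; rewrite !mxE => <-.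
rewrite (bigD1 p) // [in RHS](bigD1 p) //= (bigD1 q) ?qp //= [in RHS](bigD1 q) ?qp //=.
rewrite [in LHS](eq_bigr (fun i => v i * complex.Re (Y i i))); last first.
  by move=> i /andP[ip iq]; rewrite GYG (negbTE ip) (negbTE iq).
rewrite (GYG p) (GYG q) eqxx qp eqxx Yqp.
set S := \sum_(_ | _) _; move: (congr1 (@complex.Re R) cz).
case: z (Y p p) (Y p q) (Y q q) => z1 z2 [y1 y2] [y3 y4] [y5 y6] /= E.
have {}E : c ^+ 2 = 1 - (z1 ^+ 2 + z2 ^+ 2) by rewrite -E; ring.
set L := LHS; set RR := RHS.
apply/eqP; rewrite -subr_eq0; apply/eqP.
(* The two sides differ by a multiple of the relation between [c] and [z], made explicit so that
   [ring] applies. *)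
transitivity ((v p * y1 + v q * y5) * (c ^+ 2 - (1 - (z1 ^+ 2 + z2 ^+ 2)))); last first.
  by rewrite E subrr mulr0.
by rewrite /L /RR; ring.
Qed.

End Rotation.
End Spectrum.
End CriticalPoints.

(** * Convergence in Frobenius norm and entrywise convergence *)

Section FrobeniusConvergence.
Context {R : realType} {n : nat} {T : Type} (F : set_system T).
Hypothesis FF : Filter F.
Local Notation M := 'M[R[i]]_n.

Lemma frob_norm_sqnorm (A : M) : frob_norm A = Num.sqrt (sqnorm A).
Proof. by []. Qed.

Lemma sqnorm_ge0 (A : M) : 0 <= sqnorm A.
Proof. by apply: sumr_ge0 => k _; apply: sumr_ge0 => l _; rewrite addr_ge0 ?sqr_ge0. Qed.

Lemma sqnorm0_eq0 (A : M) : sqnorm A = 0 -> A = 0.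
Proof.
move=> A0; apply/matrixP => k l; have := sqnorm_entry A k l; rewrite A0 mxE.
case: (A k l) => x y /= xy; have := sqr_ge0 x; have := sqr_ge0 y => y0 x0.
have /eqP : x ^+ 2 = 0 by lra.
have /eqP : y ^+ 2 = 0 by lra.
by rewrite !sqrf_eq0 => /eqP -> /eqP ->.
Qed.

Lemma mrel_frob_norm (X : T -> M) (A : M) : mrel (fun f l => f @ F --> l) X A ->
  (fun t => frob_norm (X t)) @ F --> frob_norm A.
Proof.
move=> XA; have rF := @cvg_ring_relation R T F FF.
by apply: (cvg_comp _ _ (rel_sqnorm rF XA)); exact: sqrt_continuous.
Qed.

Lemma frob_norm_cvgP (X : T -> M) (A : M) :
  mrel (fun f l => f @ F --> l) X A <-> (fun t => frob_norm (X t - A)) @ F --> (0 : R).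
Proof.
have rF := @cvg_ring_relation R T F FF.
split=> [XA|H k l].
  have -> : (0 : R) = frob_norm (A - A).
    rewrite frob_norm_sqnorm subrr (_ : sqnorm 0 = 0) ?sqrtr0 //.
    by rewrite /sqnorm big1 // => k _; rewrite big1 // => l _; rewrite mxE /= !expr0n addr0.
  by apply: mrel_frob_norm; apply: mrelB => //; exact: mrel_cst.
have bound (f : M -> R) : (forall B C, f (B - C) = f B - f C) ->
    (forall B, f B ^+ 2 <= sqnorm B) -> (fun t => f (X t)) @ F --> f A.
  move=> fB fs; apply/cvgrPdist_lt => e e0.
  move/cvgrPdist_lt/(_ e e0) : H; apply: filterS => t.
  rewrite sub0r normrN (ger0_norm (sqrtr_ge0 _)); apply: le_lt_trans.
  by rewrite distrC -fB -sqrtr_sqr ler_wsqrtr.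
split.
  apply: (bound (fun B => complex.Re (B k l))) => [B C|B]; first by rewrite !mxE raddfB.
  by apply: le_trans (sqnorm_entry B k l); rewrite lerDl sqr_ge0.
apply: (bound (fun B => complex.Im (B k l))) => [B C|B]; first by rewrite !mxE raddfB.
by apply: le_trans (sqnorm_entry B k l); rewrite lerDr sqr_ge0.
Qed.

End FrobeniusConvergence.

(** * Minimizers of the overlap and descent directions of the distance *)

Section Extrema.
Context {R : realType} {n : nat}.
Local Notation M := 'M[R[i]]_n.
Variables (rhod0 P : M) (v : 'I_n -> R).
Hypotheses (PP : P *m P^t* = 1%:M) (v_inj : injective v)
  (rhod0E : rhod0 = P^t* *m real_diag v *m P) (rhod0_density : density_operator rhod0).

(** The rotations are parametrized by the tangent [u] of their angle, up to the phase [z].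
    Multiplied by [1 + u ^+ 2], the change of overlap is a polynomial: its linear term serves at
    noncritical points, its quadratic term at critical ones. *)
Lemma rotated_density (X : M) (p q : 'I_n) (z : R[i]) : isospectral_manifold rhod0 X ->
  p != q -> z * z^* = 1 -> exists X' : R -> M,
  [/\ forall u, isospectral_manifold rhod0 (X' u),
      mrel (fun (f : R -> R) l => f @ (0 : R) --> l) X' X &
      forall u, let Y := P *m X *m P^t* in
        (overlap rhod0 (X' u) - overlap rhod0 X) * (1 + u ^+ 2) = (v p - v q) *
          (u ^+ 2 * (complex.Re (Y q q) - complex.Re (Y p p)) - 2 * u * complex.Re (z * Y p q))].
Proof.
move=> Xiso pq zz; have [[Xh _ _] _] := Xiso.
pose c (u : R) := Num.sqrt (1 + u ^+ 2)^-1.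
have pos (u : R) : 0 < 1 + u ^+ 2 by rewrite ltr_wpDr ?sqr_ge0.
have cc u : c u ^+ 2 = (1 + u ^+ 2)^-1 by rewrite sqr_sqrtr // invr_ge0 ltW.
pose w (u : R) : R[i] := (u * c u)%:C%C * z.
have wc u : (w u)^* = (u * c u)%:C%C * z^*.
  by rewrite rmorphM /= -[X in X * _]/(conjc _) conjc_real.
have ww u : w u * (w u)^* = (u ^+ 2 * c u ^+ 2)%:C%C.
  by rewrite wc mulrACA zz mulr1 -rmorphM /=; congr (_%:C%C); ring.
have cw u : (c u)%:C%C ^+ 2 + w u * (w u)^* = 1.
  have E : (1 + u ^+ 2)^-1 + u ^+ 2 * (1 + u ^+ 2)^-1 = 1 by field; rewrite gt_eqF.
  by rewrite ww -rmorphXn -rmorphD /= cc E.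
pose V u := P^t* *m rotation p q (c u) (w u) *m P.
have VV u : V u *m (V u)^t* = 1%:M.
  by apply: unitaryM => //; apply: unitaryM; [exact: unitary_adj|exact: rotation_unitary].
exists (fun u => V u *m X *m (V u)^t*); split=> [u||u Y].
- by apply: isospectral_unitary.
- have rF : ring_relation (fun (f : R -> R) l => f @ (0 : R) --> l).
    exact: cvg_ring_relation.
  have c0 : c @ (0 : R) --> (1 : R).
    have -> : (1 : R) = Num.sqrt (1 + 0 ^+ 2)^-1 by rewrite expr0n addr0 invr1 sqrtr1.
    apply: (cvg_comp (fun u : R => (1 + u ^+ 2)^-1)); last exact: sqrt_continuous.
    apply: cvgV; first by rewrite gt_eqF.
    apply: cvgD; first exact: cvg_cst.
    by rewrite !expr2; apply: cvgM.
  have w0 : crel (fun (f : R -> R) l => f @ (0 : R) --> l) w 0.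
    rewrite -(mul0r z); apply: (crelM rF); last exact: (crel_cst rF).
    apply: (crel_real rF).
    have id0 : (fun u : R => u) @ (0 : R) --> (0 : R) by exact: cvg_id.
    by have := cvgM id0 c0; rewrite mul0r; apply.
  have G0 : mrel (fun (f : R -> R) l => f @ (0 : R) --> l) (fun u => rotation p q (c u) (w u)) 1%:M.
    have -> : 1%:M = rotation p q 1 0 :> M.
      apply/matrixP => i j; rewrite !mxE rmorph0 !mul0rn subr0 add0r.
      by have [->|ip] := eqVneq i p; [rewrite eq_sym|have [->|iq] := eqVneq i q; [rewrite eq_sym|]].
    have cM x y (b : bool) : crel (fun (f : R -> R) l => f @ (0 : R) --> l) x y ->
        crel (fun (f : R -> R) l => f @ (0 : R) --> l) (fun u => x u *+ b) (y *+ b).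
      by case: b => // _; exact: (crel_cst rF).
    have cc0 := crel_real rF c0.
    move=> i j; rewrite rotationE (funext (fun u => rotationE p q (c u) (w u) i j)).
    case: (i == p).
      apply: (crelD rF); first exact: cM.
      by apply: (crelN rF); apply: cM; exact: (crel_conj rF).
    case: (i == q); first by apply: (crelD rF); apply: cM.
    exact: (crel_cst rF).
  have V0 : mrel (fun (f : R -> R) l => f @ (0 : R) --> l) V 1%:M.
    rewrite -(mulmx1C PP) -(mulmx1 (P^t*)).
    by apply: (mrelM rF); [apply: (mrelM rF)|]; rewrite ?mulmx1 //; exact: (mrel_cst rF).
  have := mrelM rF (mrelM rF V0 (mrel_cst rF X)) (mrel_adj rF V0).
  by rewrite adjmx1 mul1mx mulmx1.
rewrite (overlap_rotation PP rhod0E pq (cw u) Xh) -/Y addrC addKr ww /=.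
have -> : complex.Re (w u * Y p q) = u * c u * complex.Re (z * Y p q).
  by rewrite /w -mulrA; case: (z * _) => x y /=; rewrite mul0r subr0.
rewrite (_ : 2 * c u * _ = c u ^+ 2 * (2 * u * complex.Re (z * Y p q))); last by ring.
by rewrite cc; field; rewrite gt_eqF.
Qed.

(** Follows from expanding [sqnorm (X + rhod0)], where [X] and [rhod0] have equal norms. *)
Lemma overlap_lower_bound X : isospectral_manifold rhod0 X -> - sqnorm rhod0 <= overlap rhod0 X.
Proof.
move=> Xiso; have [[Xh _ _] _] := Xiso; have [rh _ _] := rhod0_density.
have := distV_overlap PP v_inj rhod0E rhod0_density Xiso.
have XX : sqnorm X = sqnorm rhod0.
  have /(isospectralP PP v_inj rhod0E rhod0_density)[U UU ->] := Xiso.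
  rewrite !sqnorm_trace !adjmxM adjmxK !mulmxA -(mulmxA _ (U^t*) U) (mulmx1C UU) mulmx1.
  by rewrite mxtrace_mulC !mulmxA (mulmx1C UU) mul1mx.
have := sqnorm_ge0 (X + rhod0).
rewrite !sqnorm_trace in XX *; rewrite adjmxD !(hermsymmxE Xh) !(hermsymmxE rh) in XX *.
rewrite mulmxDl !mulmxDr !raddfD /= XX (mxtrace_mulC rhod0 X) -/(overlap rhod0 X).
by move=> *; lra.
Qed.

(** The unitaries of a minimizing sequence are bounded, so they converge along an ultrafilter on the
    integers. *)
Lemma overlap_minimizer : exists2 X, isospectral_manifold rhod0 X &
  forall Z, isospectral_manifold rhod0 Z -> overlap rhod0 X <= overlap rhod0 Z.
Proof.
pose S := [set overlap rhod0 X | X in isospectral_manifold rhod0].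
have hS : has_inf S.
  split; first by exists (overlap rhod0 rhod0), rhod0.
  by exists (- sqnorm rhod0) => _ [X Xiso <-]; exact: overlap_lower_bound.
have /choice[U HU] (m : nat) : exists U : M, U *m U^t* = 1%:M /\
    overlap rhod0 (U *m rhod0 *m U^t*) < inf S + m.+1%:R^-1.
  have m0 : (0 : R) < m.+1%:R^-1 by rewrite invr_gt0.
  have [_ [X Xiso <-] Xm] := inf_adherent m0 hS.
  by have /(isospectralP PP v_inj rhod0E rhod0_density)[U UU XE] := Xiso; exists U; rewrite -XE.
have [F [FU Foo]] := ultraFilterLemma eventually_filter.
have [|W UW] := @ultra_bounded_mrel R nat n F U n%:R FU.
  by move=> m; rewrite sqnorm_unitary //; exact: (HU m).1.
have FP : ProperFilter F by case: FU.
have rF : ring_relation (fun (f : nat -> R) l => f @ F --> l) by exact: cvg_ring_relation.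
have WW : W *m W^t* = 1%:M.
  have L := mrelM rF UW (mrel_adj rF UW).
  have E : (fun m => U m *m (U m)^t*) = fun=> 1%:M by apply/funext => m; exact: (HU m).1.
  by apply: (mrel_unique FP L); rewrite E; exact: (mrel_cst rF).
exists (W *m rhod0 *m W^t*); first exact: isospectral_unitary.
move=> Z Ziso; apply: (@le_trans _ _ (inf S)); last first.
  by apply: ge_inf; [exact: hS.2|exists Z].
have L1 : (fun m => overlap rhod0 (U m *m rhod0 *m (U m)^t*)) @ F -->
    overlap rhod0 (W *m rhod0 *m W^t*).
  have := mrelM rF (mrelM rF UW (mrel_cst rF rhod0)) (mrel_adj rF UW).
  by move=> L; exact: (mrel_trace rF (mrelM rF L (mrel_cst rF rhod0))).1.
have L2 : (fun m : nat => inf S + m.+1%:R^-1) @ F --> inf S.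
  have : (fun m : nat => inf S + m.+1%:R^-1) @ \oo --> inf S + 0.
    by apply: cvgD; [exact: cvg_cst|exact: cvg_harmonic].
  by rewrite addr0; apply: cvg_trans => A /Foo.
apply: (ler_cvg_to L1 L2).
by apply: filterE => m; exact/ltW/(HU m).2.
Qed.

Lemma overlap_minimizer_critical X : isospectral_manifold rhod0 X ->
  (forall Z, isospectral_manifold rhod0 Z -> overlap rhod0 X <= overlap rhod0 Z) ->
  critical_points rhod0 X.
Proof.
move=> Xiso Xmin; split=> //; apply: contrapT => XC.
pose Y := P *m X *m P^t*.
have [p [q [pq Ypq]]] : exists p q, p != q /\ Y p q != 0.
  apply: contrapT => none; apply: XC.
  have Yd p q : p != q -> Y p q = 0.
    move=> pq; apply: contrapT => /eqP Ypq; apply: none.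
    by exists p, q.
  have YD : Y *m real_diag v = real_diag v *m Y.
    apply/matrixP => i j; rewrite real_diag_def mul_diag_mx mul_mx_diag !mxE.
    have [->|ij] := eqVneq i j; first by rewrite mulrC.
    by have := Yd i j ij; rewrite mxE => ->; rewrite mul0r mulr0.
  have -> : X = P^t* *m Y *m P by rewrite /Y unitary_conjVK.
  rewrite /bracket rhod0E (unitary_conj_mul Y (real_diag v) PP).
  by rewrite (unitary_conj_mul (real_diag v) Y PP) YD subrr.
(* A phase 1 or [i] gives the off-diagonal entry a nonzero real part, hence a first-order change of
   the overlap. *)
have [z zz zY] : exists2 z : R[i], z * z^* = 1 & complex.Re (z * Y p q) != 0.
  have [Re0|Re0] := eqVneq (complex.Re (Y p q)) 0; last first.
    by exists 1; [rewrite rmorph1 mulr1|rewrite mul1r].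
  exists 'i%C.
    by apply/eqP; rewrite eq_complex /= !mul0r !mulr0 !mul1r sub0r opprK addr0 !eqxx.
  case: (Y p q) Ypq Re0 => x y /= + x0; rewrite x0 mul0r mul1r sub0r oppr_eq0.
  by apply: contraNneq => ->.
have [X' [Xi _ XE]] := rotated_density Xiso pq zz.
pose A := complex.Re (Y q q) - complex.Re (Y p p).
pose B := complex.Re (z * Y p q).
pose k := v p - v q.
have k0 : k != 0 by rewrite subr_eq0 (inj_eq v_inj).
(* With this [eta] and [u := k * B * eta] the quadratic term offsets at most half of the linear one,
   so the overlap decreases strictly. *)
pose eta := (`|k * A| + 1)^-1.
have D0 : 0 < `|k * A| + 1 by rewrite ltr_wpDl.
have eta0 : 0 < eta by rewrite invr_gt0.
have kA : k * A * eta <= 1.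
  by rewrite /eta ler_pdivrMr // mul1r; apply: le_trans (ler_norm _) _; rewrite lerDl.
pose u := k * B * eta.
have {XE} : (overlap rhod0 (X' u) - overlap rhod0 X) * (1 + u ^+ 2) =
  k * (u ^+ 2 * A - 2 * u * B) := XE u.
have -> : k * (u ^+ 2 * A - 2 * u * B) = (k * B) ^+ 2 * eta * (k * A * eta - 2).
  by rewrite /u; ring.
move=> E; have : 0 <= (overlap rhod0 (X' u) - overlap rhod0 X) * (1 + u ^+ 2).
  by apply: mulr_ge0; [rewrite subr_ge0 Xmin|rewrite addr_ge0 ?sqr_ge0].
rewrite E leNgt => /negP; apply.
have D : 0 < (k * B) ^+ 2 * eta.
  by rewrite mulr_gt0 // exprn_even_gt0 //= mulf_neq0.
by rewrite pmulr_rlt0 //; lra.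
Qed.

Lemma critical_point1 : critical_point P v 1%g = rhod0.
Proof.
by rewrite /critical_point rhod0E (_ : v \o _ = v) //; apply/funext => i /=; rewrite perm1.
Qed.

(** A small rotation mixing two eigenvectors whose eigenvalues are inverted raises the overlap at
    second order, and so lowers the distance. *)
Lemma critical_point_lower (s : {perm 'I_n}) (delta : R) : s != 1%g -> 0 < delta ->
  exists X, [/\ isospectral_manifold rhod0 X, frob_norm (X - critical_point P v s) < delta &
    distV X rhod0 < distV (critical_point P v s) rhod0].
Proof.
move=> s1 d0.
(* The displaced index [p] of largest eigenvalue and its preimage [q] form the inverted pair:
   [v q < v p], while the critical point has [v p] at [q] and the smaller [v (s p)] at [p]. *)
have [p sp vmax] : exists2 p, s p != p & forall q, s q != q -> v q <= v p.
  have [p0 sp0] : exists p, s p != p.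
    apply: contrapT => none; move/eqP : s1; apply; apply/permP => i; rewrite perm1.
    by apply: contrapT => /eqP si; apply: none; exists i.
  by case: (@arg_maxP _ R _ p0 (fun p => s p != p) v sp0) => p sp vp; exists p.
pose q := (s^-1)%g p.
have sq : s q = p by rewrite permKV.
have qp : q != p by apply: contraNneq sp => qp; rewrite -{1}qp sq.
have vqp : v q < v p.
  by rewrite lt_neqAle (inj_eq v_inj) qp vmax // sq eq_sym.
have vsp : v (s p) < v p.
  rewrite lt_neqAle (inj_eq v_inj) sp vmax //.
  by apply: contra sp => /eqP/perm_inj/eqP.
have pq : p != q by rewrite eq_sym.
have [Xiso _] := critical_point_critical PP v_inj rhod0E rhod0_density s.
have [|X' [Xi /frob_norm_cvgP X0 XE]] := rotated_density Xiso pq (z := 1).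
  by rewrite rmorph1 mulr1.
have /cvgrPdist_lt/(_ delta d0) /nbhs_ballP[e /= e0 He] := X0.
pose u := e / 2; have u0 : 0 < u by rewrite divr_gt0.
exists (X' u); split => //.
  have := He u; rewrite /ball /= sub0r normrN gtr0_norm // => /(_ _).
  rewrite sub0r normrN ger0_norm; last by rewrite frob_norm_sqnorm sqrtr_ge0.
  by apply; rewrite /u; lra.
rewrite !(distV_overlap PP v_inj rhod0E rhod0_density) // ltrD2l ltrN2.
have := XE u; rewrite /= /critical_point unitary_conjK // !real_diagE !eqxx (negbTE pq).
rewrite /= mulr0 mulr0 subr0 sq => E.
rewrite -subr_gt0 -(pmulr_lgt0 _ (_ : 0 < 1 + u ^+ 2)) ?ltr_wpDr ?sqr_ge0 // E mulr0 subr0.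
by rewrite !mulr_gt0 ?exprn_gt0 ?subr_gt0.
Qed.

End Extrema.

(** * Convergence of trajectories and stability of critical points *)

Section Convergence.
Context {R : realType}.

Lemma finite_lower_bound (I : finType) (g : I -> R) : (forall i, 0 < g i) ->
  exists2 r, 0 < r & forall i, r <= g i.
Proof.
move=> g0; have [r [r0 rg]] : exists r, 0 < r /\ forall i, i \in enum I -> r <= g i.
  elim: (enum I) => [|i l [r [r0 rl]]]; first by exists 1.
  exists (Num.min r (g i)); split; first by rewrite lt_min r0 g0.
  move=> j; rewrite inE => /orP[/eqP ->|/rl rj]; first by rewrite ge_min lexx orbT.
  by rewrite ge_min rj.
by exists r => // i; apply: rg; rewrite mem_enum.
Qed.

(** If [Q] failed at arbitrarily large times, some ultrafilter tending to +oo would contain its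
    complement. This turns facts about ultrafilter limits into statements about all late times. *)
Lemma near_pinfty_ultra (Q : R -> Prop) :
  (forall F : set_system R, UltraFilter F -> F --> +oo -> F (~` [set t | Q t]) -> False) ->
  \forall t \near +oo, Q t.
Proof.
move=> H; apply: contrapT => nQ.
have PF : ProperFilter (within (~` [set t | Q t]) (pinfty_nbhs R)).
  split; last exact: within_filter.
  move=> W; apply: nQ; apply: (@filterS _ (pinfty_nbhs R) _ _ _ _ W) => t /= H'.
  exact: contrapT.
have [F [FU Fle]] := ultraFilterLemma PF.
apply: (H F FU).
  by move=> A Aoo; apply: Fle; apply: (@filterS _ (pinfty_nbhs R) _ _ _ _ Aoo) => t At _.
by apply: Fle; exact: withinT.
Qed.

Variable n : nat.
Local Notation M := 'M[R[i]]_n.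

(** Parallelogram identity: the gap between the two sides is the squared norm of [2 C - A - B]. *)
Lemma sqnorm_quasi_triangle (A B C : M) :
  sqnorm (A - B) <= 2 * (sqnorm (C - A) + sqnorm (C - B)).
Proof.
rewrite /sqnorm -big_split mulr_sumr; apply: ler_sum => k _ /=.
rewrite -big_split mulr_sumr; apply: ler_sum => l _ /=.
rewrite !mxE; case: (A k l) (B k l) (C k l) => a1 a2 [b1 b2] [c1 c2] /=.
have := sqr_ge0 (2 * c1 - a1 - b1); have := sqr_ge0 (2 * c2 - a2 - b2); nra.
Qed.

Variables (a : 'rV[R]_n) (H1 rhod0 P : M) (v : 'I_n -> R).
Hypotheses (H1_herm : H1 \is hermsymmx) (rhod0_density : density_operator rhod0)
  (PP : P *m P^t* = 1%:M) (v_inj : injective v)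
  (rhod0E : rhod0 = P^t* *m real_diag v *m P)
  (E_regular : LaSalle_regular (diag_hamiltonian a) H1 rhod0).
Local Notation crit := (critical_point P v).
Local Notation H0 := (diag_hamiltonian a).

Lemma critical_separation : exists2 r, 0 < r &
  forall s t : {perm 'I_n}, s != t -> r <= sqnorm (crit s - crit t).
Proof.
(* Equal pairs get the dummy value 1, so that the minimum over all pairs is positive. *)
pose g (st : {perm 'I_n} * {perm 'I_n}) : R :=
  if st.1 == st.2 then 1 else sqnorm (crit st.1 - crit st.2).
have [|r r0 rg] := @finite_lower_bound _ g.
  move=> [s t]; rewrite /g /=; case: eqVneq => // st.
  rewrite lt_neqAle sqnorm_ge0 andbT eq_sym; apply: contraNneq st => /sqnorm0_eq0/eqP.
  by rewrite subr_eq0 => /eqP /(critical_point_inj PP v_inj) ->.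
by exists r => // s t st; have := rg (s, t); rewrite /g /= (negbTE st).
Qed.

(* All limit points are isolated critical points, so the trajectory, being continuous,
   cannot jump between their neighbourhoods. *)
Theorem interaction_converges (sigma : R -> M) : interaction a H1 rhod0 sigma ->
  isospectral_manifold rhod0 (sigma 0) ->
  exists s, mrel (fun (f : R -> R) l => f @ +oo --> l) sigma (crit s).
Proof.
move=> dsigma sigma0.
have [r r0 sep] := critical_separation.
pose d s t := sqnorm (sigma t - crit s).
have limit (F : set_system R) : UltraFilter F -> F --> +oo ->
    exists j, forall s, d s @ F --> sqnorm (crit j - crit s).
  move=> FU Foo; have rF : ring_relation (fun (f : R -> R) l => f @ F --> l).
    exact: cvg_ring_relation.
  have [|A XA] := @ultra_bounded_mrel R R n F (fun t : R => sigma `|t|) (sqnorm (sigma 0)) FU.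
    by move=> t; rewrite (interaction_sqnorm H1_herm dsigma).
  have sA : mrel (fun (f : R -> R) l => f @ F --> l) sigma A.
    have ev : \forall t \near F, sigma `|t| = sigma t.
      by apply: filterS (Foo _ (near_pinfty_ge 0)) => t t0; rewrite ger0_norm.
    move=> k l; have [U1 U2] := XA k l; split.
      by apply: cvg_trans U1; apply: near_eq_cvg; apply: filterS ev => t /= ->.
    by apply: cvg_trans U2; apply: near_eq_cvg; apply: filterS ev => t /= ->.
  have := limit_critical H1_herm rhod0_density dsigma sigma0 FU Foo E_regular sA.
  move=> /(critical_pointP PP v_inj rhod0E)[j Aj].
  exists j => s; rewrite -Aj; apply: (rel_sqnorm rF).
  by apply: (mrelB rF) => //; exact: (mrel_cst rF).
have sq0 : sqnorm (0 : M) = 0.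
  by rewrite /sqnorm big1 // => k _; rewrite big1 // => l _; rewrite mxE /= !expr0n addr0.
(* By the quasi-triangle inequality, [4 q < r] keeps a point from being within squared distance [q]
   of two critical points. *)
pose q := r / 8; have q0 : 0 < q by rewrite divr_gt0.
have q4 : 2 * (q + q) < r by rewrite /q; lra.
have qr : q < r by rewrite /q; lra.
have close s t u : d s u <= q -> d t u <= q -> s = t.
  move=> su tu; apply: contrapT => /eqP /sep; rewrite leNgt => /negP; apply.
  apply: le_lt_trans (sqnorm_quasi_triangle _ _ (sigma u)) _.
  apply: (@le_lt_trans _ _ (2 * (q + q))); last exact: q4.
  by rewrite ler_pM2l //; exact: (lerD su tu).
have [T [_ HT]] : \forall t \near +oo, exists s, d s t < q.
  apply: near_pinfty_ultra => F FU Foo Fn; have [j dj] := limit F FU Foo.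
  have := dj j; rewrite subrr sq0 => /cvgrPdist_lt/(_ q q0) Fq.
  have [t [/= nt tq]] := filter_ex (filterI Fn Fq); apply: nt; exists j.
  by move: tq; rewrite sub0r normrN ger0_norm ?sqnorm_ge0.
pose T0 := `|T| + 1.
have TT0 t : T0 <= t -> T < t by have := ler_norm T; rewrite /T0; lra.
have T00 : 0 <= T0 by rewrite addr_ge0.
have [s sT0] := HT T0 (TT0 T0 (lexx _)).
have dc : hcont (d s).
  move=> t t0; have rF : ring_relation (fun (f : R -> R) l => f @ hnbhs t --> l).
    exact: cvg_ring_relation.
  by apply: (rel_sqnorm rF); apply: (mrelB rF); [exact: dsigma.1|exact: (mrel_cst rF)].
(* By the intermediate value theorem a later exit would meet [d s = q] exactly, at a time when some
   critical point is at squared distance less than [q]; it could only be [s] itself. *)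
have stay t : T0 <= t -> d s t < q.
  move=> Tt; rewrite ltNge; apply/negP => qt.
  have sub : {within `[T0, t], continuous (d s)}.
    move/hcontE : dc; apply: continuous_subspaceW => x /=.
    by rewrite !in_itv /= andbT => /andP[/(le_trans T00) ->].
  have [|c] := @IVT R (d s) T0 t q Tt sub.
    by rewrite ge_min (ltW sT0) le_max qt orbT.
  rewrite in_itv /= => /andP[Tc _] dq.
  have [j jc] := HT c (TT0 c Tc).
  have dle : d s c <= q by rewrite dq lexx.
  have E : s = j := close s j c dle (ltW jc).
  by move: jc; rewrite -E dq ltxx.
exists s; apply/frob_norm_cvgP/cvgrPdist_lt => e e0.
apply: near_pinfty_ultra => F FU Foo Fn; have [j dj] := limit F FU Foo.
(* The limit along the ultrafilter is a critical point within squared distance [q] of [crit s], and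
   separation leaves only one. *)
have Ej : j = s.
  apply: contrapT => /eqP /sep js.
  have : sqnorm (crit j - crit s) <= q.
    apply: (ler_cvg_to (dj s) (cvg_cst q)).
    by apply: filterS (Foo _ (near_pinfty_ge T0)) => t /stay/ltW.
  by move=> /(le_trans js); rewrite leNgt qr.
have := dj s; rewrite Ej subrr sq0 => /cvgrPdist_lt/(_ (e ^+ 2)) Fe.
have [|t [/= nt te]] := filter_ex (filterI Fn (Fe _)); first by rewrite exprn_gt0.
apply: nt; rewrite sub0r normrN ger0_norm ?sqrtr_ge0 // frob_norm_sqnorm.
move: te; rewrite sub0r normrN ger0_norm ?sqnorm_ge0 // => te.
by rewrite -[ltRHS](gtr0_norm e0) -sqrtr_sqr ltr_sqrt // exprn_gt0.
Qed.

Section Trajectory.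
Variable rho : R -> M.
Hypothesis rho_trajectory : trajectory H0 H1 rhod0 rho.
Local Notation sigma := (fun t => twist a (rho t) (- t)).

Lemma trajectory_interaction : interaction a H1 rhod0 sigma.
Proof. by apply/controlledE; case: rho_trajectory. Qed.

Lemma trajectory_isospectral t : 0 <= t -> isospectral_manifold rhod0 (sigma t).
Proof.
move=> t0; apply: (interaction_isospectral H1_herm trajectory_interaction t0).
by rewrite oppr0 twist0; case: rho_trajectory.
Qed.

Lemma frob_norm_twist (X : M) t : frob_norm (rho t - free_evolution H0 X t) =
  frob_norm (sigma t - X).
Proof.
rewrite free_evolutionE !frob_norm_sqnorm -(twist_sqnorm a _ (- t)).
by rewrite twistB twistK.
Qed.

Lemma converges_toE (X : M) : converges_to H0 rho X <->
  mrel (fun (f : R -> R) l => f @ +oo --> l) sigma X.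
Proof.
rewrite frob_norm_cvgP /converges_to.
by rewrite (_ : (fun t => frob_norm (rho t - _)) = (fun t => frob_norm (sigma t - X)))
  //; apply/funext => t; exact: frob_norm_twist.
Qed.

Lemma trajectory_converges : exists s, converges_to H0 rho (crit s).
Proof.
have [|s sc] := interaction_converges trajectory_interaction; last first.
  by exists s; apply/converges_toE.
exact: trajectory_isospectral.
Qed.

Lemma distV_nonincreasing s t : 0 <= s -> s <= t ->
  distV (sigma t) rhod0 <= distV (sigma s) rhod0.
Proof.
move=> s0 st; rewrite -lerN2.
apply: (hder_mono (hderN (interaction_distV trajectory_interaction)) _ s0 st) => r _.
by rewrite opprK sqr_ge0.
Qed.

Lemma distV_limit (X : M) t : converges_to H0 rho X -> 0 <= t ->
  distV X rhod0 <= distV (sigma t) rhod0.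
Proof.
move=> /converges_toE sX t0.
have rF : ring_relation (fun (f : R -> R) l => f @ +oo --> l) by exact: cvg_ring_relation.
have L := rel_distV rF sX (mrel_cst rF rhod0).
apply: (ler_cvg_to L (cvg_cst _)).
by apply: filterS (near_pinfty_ge t) => u tu; exact: distV_nonincreasing.
Qed.

Lemma frob_norm_distV t : 0 <= t ->
  frob_norm (rho t - free_evolution H0 rhod0 t) = Num.sqrt (2 * distV (sigma t) rhod0).
Proof.
move=> t0; have [[sh _ _] _] := trajectory_isospectral t0.
have [rh _ _] := rhod0_density.
rewrite frob_norm_twist (distV_sqnorm sh rh) frob_norm_sqnorm; congr Num.sqrt.
by field.
Qed.

End Trajectory.

Lemma trajectory_exists (X : M) : isospectral_manifold rhod0 X ->
  exists2 rho, trajectory H0 H1 rhod0 rho & rho 0 = X.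
Proof.
move=> Xiso; have [sigma s0 dsigma] := interaction_exists a rhod0 H1_herm X.
exists (fun t => twist a (sigma t) t); last by rewrite twist0.
split; first by rewrite twist0 s0.
apply/controlledE; rewrite (_ : (fun t => _) = sigma) //.
by apply/funext => t; rewrite twistK.
Qed.

(** The distance to the target is the square root of twice [V], which does not increase, so
    [delta = eps] works. *)
Lemma rhod0_stable : stable H0 H1 rhod0 rhod0.
Proof.
move=> eps e0; exists eps => // rho rt; have E := frob_norm_distV rt.
have := E 0 (lexx 0); rewrite [in LHS]free_evolutionE twist0 => -> rd t t0.
rewrite (E t t0).
apply: le_lt_trans rd; rewrite ler_wsqrtr // ler_pM2l //.
exact: distV_nonincreasing.
Qed.

Lemma rhod0_asymptotically_stable : locally_asymptotically_stable H0 H1 rhod0 rhod0.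
Proof.
split; first exact: rhod0_stable.
have [rh _ _] := rhod0_density.
have [r r0 sep] := critical_separation.
(* Starting within [Num.sqrt r] of the target means [2 V < r], whereas a limit other than [rhod0]
   would force [2 V >= r]. *)
exists (Num.sqrt r); first by rewrite sqrtr_gt0.
move=> rho rt; have := frob_norm_distV rt (lexx 0).
rewrite [in LHS]free_evolutionE twist0 => -> d0.
have [s rs] := trajectory_converges rt.
suff s1 : s = 1%g by move: rs; rewrite s1 (critical_point1 rhod0E).
apply: contrapT => /eqP /sep; rewrite (critical_point1 rhod0E) leNgt => /negP; apply.
have [[[ch _ _] _] _] := critical_point_critical PP v_inj rhod0E rhod0_density s.
have := distV_limit rt rs (lexx 0); rewrite (distV_sqnorm ch rh).
by move: d0; rewrite ltr_sqrt //; lra.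
Qed.

Lemma maximal_repulsive (s : {perm 'I_n}) :
  (forall t, distV (crit t) rhod0 <= distV (crit s) rhod0) ->
  repulsive H0 H1 rhod0 (crit s).
Proof.
move=> smax rho rt rs.
(* The hypothesis [smax] compares critical points only; as a global minimizer of the overlap exists
   and is critical, [crit s] maximizes the distance over the whole manifold. *)
have [X Xiso Xmin] := overlap_minimizer PP v_inj rhod0E rhod0_density.
have [j Xj] := critical_pointP PP v_inj rhod0E
  (overlap_minimizer_critical PP v_inj rhod0E Xiso Xmin).
have dO Z (Ziso : isospectral_manifold rhod0 Z) := distV_overlap PP v_inj rhod0E rhod0_density Ziso.
pose sigma t := twist a (rho t) (- t).
have siso t : 0 <= t -> isospectral_manifold rhod0 (sigma t) by exact: trajectory_isospectral.
(* The distance along the trajectory is at least its limit, which is maximal; so every [sigma t]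
   minimizes the overlap and is critical. *)
have scrit t : 0 <= t -> bracket (sigma t) rhod0 = 0.
  move=> t0; have [_ //] : critical_points rhod0 (sigma t).
  apply: (overlap_minimizer_critical PP v_inj rhod0E (siso t t0)) => Z Ziso.
  apply: le_trans (Xmin Z Ziso).
  have := distV_limit rt rs t0; have := smax j; rewrite -Xj -/(sigma t).
  by rewrite (dO X Xiso) (dO (sigma t) (siso t t0)); lra.
have dsigma := trajectory_interaction rt.
(* A vanishing commutator with [rhod0] makes the feedback vanish, and with it the velocity. *)
have const t : 0 <= t -> sigma t = sigma 0.
  apply: (msol_eq0 dsigma) => u u0.
  have [[sh _ _] _] := siso u (ltW u0).
  rewrite (_ : feedback _ _ _ = 0) ?scale0r //.
  have := feedback_trigonometric a H1_herm rhod0_density u sh.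
  rewrite (scrit u (ltW u0)) big1 => [/(congr1 (@complex.Re R)) //|p _].
  by rewrite mxE !mulr0 mul0r.
have s0 : sigma 0 = crit s.
  have rF : ring_relation (fun (f : R -> R) l => f @ +oo --> l) by exact: cvg_ring_relation.
  have /converges_toE sX := rs.
  apply: (mrel_unique _ _ sX) => k l.
  have [C1 C2] := mrel_cst rF (sigma 0) k l.
  have ev : \forall t \near +oo, sigma 0 = sigma t.
    by apply: filterS (near_pinfty_ge 0) => t t0; rewrite const.
  split.
    by apply: cvg_trans C1; apply: near_eq_cvg; apply: filterS ev => t /= ->.
  by apply: cvg_trans C2; apply: near_eq_cvg; apply: filterS ev => t /= ->.
by move=> t t0; rewrite free_evolutionE -s0 -(const t t0) /sigma twistNK.
Qed.

(** A trajectory started arbitrarily near [crit s], where [V] is lower, has a limit with lower [V]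
    too; that limit is another critical point, too far away for stability. *)
Lemma critical_unstable (s : {perm 'I_n}) : crit s <> rhod0 -> ~ stable H0 H1 rhod0 (crit s).
Proof.
move=> srhod sst.
have s1 : s != 1%g by apply/eqP => s1; apply: srhod; rewrite s1 (critical_point1 rhod0E).
have [r r0 sep] := critical_separation.
(* Half of a lower bound for the distances between critical points: a trajectory that stays this
   close to [crit s] cannot converge to another one. *)
have r20 : 0 < Num.sqrt r / 2 by rewrite divr_gt0 // sqrtr_gt0.
have [delta d0 Hd] := sst _ r20.
have [X [Xiso Xd XV]] := critical_point_lower PP v_inj rhod0E rhod0_density s1 d0.
have [rho rt rho0] := trajectory_exists Xiso.
have [j rj] := trajectory_converges rt.
have sj : j != s.
  apply: contraTneq XV => <-; rewrite -leNgt.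
  by have := distV_limit rt rj (lexx 0); rewrite oppr0 twist0 rho0.
have := sep j s sj; rewrite leNgt => /negP; apply.
have rF : ring_relation (fun (f : R -> R) l => f @ +oo --> l) by exact: cvg_ring_relation.
have /converges_toE L := rj.
have /mrel_frob_norm LN := mrelB rF L (mrel_cst rF (crit s)).
have : frob_norm (crit j - crit s) <= Num.sqrt r / 2.
  apply: (ler_cvg_to LN (cvg_cst _)).
  apply: filterS (near_pinfty_ge 0) => t t0; rewrite -frob_norm_twist.
  by apply/ltW/Hd => //; rewrite rho0.
move=> le2; rewrite -ltr_sqrt //; apply: le_lt_trans le2 _.
by have := r20; lra.
Qed.

End Convergence.

Theorem theoremV4 (R : realType) (n : nat)
    (a : 'rV[R]_n) (H1 rhod0 : 'M[R[i]]_n)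
    (a_decr : forall k l : 'I_n, (k <= l)%N -> a 0 l <= a 0 k)
    (H1_herm : H1 \is hermsymmx)
    (ideal_H : ideal a H1)
    (rhod0_density : density_operator rhod0)
    (rhod0_generic : generic rhod0)
    (rhod0_nonstationary : bracket (diag_hamiltonian a) rhod0 != 0)
    (E_regular : LaSalle_regular (diag_hamiltonian a) H1 rhod0) :
  let H0 := diag_hamiltonian a in
  exists2 crit : 'I_(n`!) -> 'M[R[i]]_n,
    set_bij [set: 'I_(n`!)] (critical_points rhod0) crit &
    let is_max k := forall j, distV (crit j) rhod0 <= distV (crit k) rhod0 in
    [/\ forall rho : R -> 'M[R[i]]_n, trajectory H0 H1 rhod0 rho ->
          exists k, converges_to H0 rho (crit k),
        locally_asymptotically_stable H0 H1 rhod0 rhod0,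
        forall k, is_max k -> repulsive H0 H1 rhod0 (crit k) &
        forall k, crit k <> rhod0 -> ~ is_max k ->
          ~ stable H0 H1 rhod0 (crit k)].
Proof.
move=> H0.
have [P [v [PP v_inj rhod0E]]] := generic_diagonalization rhod0_density rhod0_generic.
pose sigma (k : 'I_(n`!)) : {perm 'I_n} := enum_val (cast_ord (esym (card_Sn n)) k).
have sigmaK s : exists k, sigma k = s.
  exists (cast_ord (card_Sn n) (enum_rank s)).
  by rewrite /sigma cast_ord_comp cast_ord_id enum_rankK.
exists (fun k => critical_point P v (sigma k)).
  split.
  - by move=> k _; exact: critical_point_critical PP v_inj rhod0E rhod0_density (sigma k).
  - move=> j k _ _ /(critical_point_inj PP v_inj) /enum_val_inj.
    exact: cast_ord_inj.
  move=> X /(critical_pointP PP v_inj rhod0E)[s ->]; have [k <-] := sigmaK s.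
  by exists k; [exact: I|exact: erefl].
move=> is_max; split.
- move=> rho rt.
  have [s rs] := trajectory_converges H1_herm rhod0_density PP v_inj rhod0E E_regular rt.
  by have [k ks] := sigmaK s; exists k; rewrite ks.
- exact: rhod0_asymptotically_stable H1_herm rhod0_density PP v_inj rhod0E E_regular.
- move=> k kmax; apply: (maximal_repulsive H1_herm rhod0_density PP v_inj rhod0E) => s.
  by have [j <-] := sigmaK s; exact: kmax.
- move=> k krhod _.
  exact: critical_unstable H1_herm rhod0_density PP v_inj rhod0E E_regular _ krhod.
Qed.
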